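(* Let $\phi_1,\psi_1,\phi_2,\psi_2$ be states on $\mathcal{A}$. For $l\in\{1,2\}$ and $m\in\mathbb{N}$ let $\widetilde{\Phi}_l^{(m)}=\widetilde{\phi}_l\otimes\widetilde{\psi}_l^{\otimes(m-1)}$ and $\widehat{\Phi}_l^{(m)}=\widetilde{\Phi}_l^{(m)}\circ\eta$. Then $$\lim_{m\to\infty}\left(\widehat{\Phi}_1^{(m)}\star\widehat{\Phi}_2^{(m)}\right)\circ\widehat{i}_1=(\phi_1,\psi_1)\star(\phi_2,\psi_2)$$ pointwise on $\mathcal{A}$, where $(\phi_1,\psi_1)\star(\phi_2,\psi_2)=\left( *_{i\in\{1,2\}}(\phi_i,\psi_i)\right)\circ\delta$ is the conditionally free convolution of states.
   Context: $\mathcal{A}$ is the unital free *-algebra over $\mathbb{C}$ generated by a set $\mathcal{G}^+$: the free unital algebra on the letters $\mathcal{G}=\mathcal{G}^+\cup\mathcal{G}^-$, $\mathcal{G}^-=\{a^*:a\in\mathcal{G}^+\}$, with words as linear basis and involution the antilinear extension of $(a_1\ldots a_k)^*=a_k^*\ldots a_1^*$. A state on a unital *-algebra is a linear functional $\phi$ with $\phi(\mathbf{1})=1$ and $\phi(xx^* )\ge0$. $\widetilde{\mathcal{A}}=\mathcal{A}*\mathbb{C}[t]$ is the free product with identified units, $t=t^*$. For a state $\phi$ on $\mathcal{A}$, its Boolean extension $\widetilde{\phi}$ is the state on $\widetilde{\mathcal{A}}$ which is the linear extension of $\widetilde{\phi}(\mathbf{1})=1$ (more generally $\widetilde\phi(t^r)=1$)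 and $\widetilde{\phi}(t_0w_1t_1\ldots w_nt_n)=\phi(w_1)\ldots\phi(w_n)$, where $w_1,\ldots,w_n$ are non-empty words in $\mathcal{A}$ and $t_0,\ldots,t_n$ are powers of $t$ with $t_1,\ldots,t_{n-1}\ne\mathbf{1}$. $\widetilde{\mathcal{A}}^{*(m)}$ is the $m$-fold free product $\widetilde{\mathcal{A}}*\cdots*\widetilde{\mathcal{A}}$ (units identified); $a_{(i)},t_{(i)}$ are the copies of $a\in\mathcal{G}$ and $t$ in the $i$-th factor; $t_{[k,m]}=t_{(k)}\ldots t_{(m)}$. The map $\eta:\widetilde{\mathcal{A}}^{*(m)}\to\widetilde{\mathcal{A}}^{\otimes m}$ is the canonical *-homomorphism (quotient by the commutation relations between different copies) sending the $i$-th copy $x_{(i)}$ of $x\in\widetilde{\mathcal{A}}$ to $\mathbf{1}^{\otimes(i-1)}\otimes x\otimes\mathbf{1}^{\otimes(m-i)}$. The coproduct $\Delta^{(m)}:\widetilde{\mathcal{A}}^{*(m)}\to\widetilde{\mathcal{A}}^{*(m)}\otimes\widetilde{\mathcal{A}}^{*(m)}$ is the unital *-homomorphism determined by $\Delta^{(m)}(t_{(i)})=t_{(i)}\otimes t_{(i)}$ and $\Delta^{(m)}(a_{(k)}-a_{(k+1)})=(a_{(k)}-a_{(k+1)})\otimes t_{[k,m]}+t_{[k,m]}\otimes(a_{(k)}-a_{(k+1)})$ for $a\in\mathcal{G}^+$, $1\le i,k\le m$, with $a_{(m+1)}=0$. The convolution of two states on $\widetilde{\mathcal{A}}^{*(m)}$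 is $\Gamma_1\star\Gamma_2=(\Gamma_1\otimes\Gamma_2)\circ\Delta^{(m)}$. $\widehat{i}_1:\mathcal{A}\to\widetilde{\mathcal{A}}^{*(m)}$ is the *-homomorphism $a\mapsto a_{(1)}$. $\delta:\mathcal{A}\to\mathcal{A}*\mathcal{A}$ is the unital *-homomorphism with $\delta(a)=a^{(1)}+a^{(2)}$, $a\in\mathcal{G}$, where $a^{(1)},a^{(2)}$ are the copies of $a$ in the first and second factor. The conditionally free product $\phi=*_{i\in\{1,2\}}(\phi_i,\psi_i)$ is the state on $\mathcal{A}_1*\mathcal{A}_2$ ($\mathcal{A}_1=\mathcal{A}_2=\mathcal{A}$, units identified) determined by $\phi(\mathbf{1})=1$ and $\phi(a_1\ldots a_n)=\phi_{k_1}(a_1)\ldots\phi_{k_n}(a_n)$ whenever $a_j\in\mathcal{A}_{k_j}$, $\psi_{k_j}(a_j)=0$ and $k_1\ne k_2\ne\cdots\ne k_n$. *)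

(* Defs.v *)
From HB Require Import structures.
From mathcomp Require Import all_boot all_order all_algebra finmap complex monalg.

Set Implicit Arguments.
Unset Strict Implicit.
Unset Printing Implicit Defensive.

Import GRing.Theory Num.Theory.

Local Open Scope ring_scope.

(* All algebras below are monoid algebras {malg C[K]} : the free algebra on a
   set L of letters is {malg C[{fmonom L}]} (its basis is the monoid of words),
   free products of free algebras are free algebras on disjoint unions of
   alphabets, and a tensor product of monoid algebras is the monoid algebra of
   the product monoid. *)

(* The coercion to a numClosedFieldType gives access to the norm topology. *)
Definition Cplx (R : rcfType) : numClosedFieldType := complex R.

Section ProductMonoids.
Variables (K1 K2 K : monomType) (I : finType).

Definition prod_one : K1 * K2 := (mone, mone).
Definition prod_mul (x y : K1 * K2) : K1 * K2 := (mmul x.1 y.1, mmul x.2 y.2).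

Lemma prod_mulA : associative prod_mul.
Proof. by move=> x y z; rewrite /prod_mul /= !mulmA. Qed.
Lemma prod_mul1m : left_id prod_one prod_mul.
Proof. by move=> [x y]; rewrite /prod_mul /= !mul1m. Qed.
Lemma prod_mulm1 : right_id prod_one prod_mul.
Proof. by move=> [x y]; rewrite /prod_mul /= !mulm1. Qed.
Lemma prod_unitm x y :
  prod_mul x y = prod_one -> x = prod_one /\ y = prod_one.
Proof.
by move: x y => [x1 x2] [y1 y2] [] /unitm[-> ->] /unitm[-> ->].
Qed.

HB.instance Definition _ := Choice_isMonomialDef.Build (K1 * K2)%type
  prod_mulA prod_mul1m prod_mulm1 prod_unitm.

Definition ffun_one : {ffun I -> K} := [ffun=> mone].
Definition ffun_mul (x y : {ffun I -> K}) : {ffun I -> K} :=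
  [ffun i => mmul (x i) (y i)].

Lemma ffun_mulA : associative ffun_mul.
Proof. by move=> x y z; apply/ffunP => i; rewrite !ffunE mulmA. Qed.
Lemma ffun_mul1m : left_id ffun_one ffun_mul.
Proof. by move=> x; apply/ffunP => i; rewrite !ffunE mul1m. Qed.
Lemma ffun_mulm1 : right_id ffun_one ffun_mul.
Proof. by move=> x; apply/ffunP => i; rewrite !ffunE mulm1. Qed.
Lemma ffun_unitm x y :
  ffun_mul x y = ffun_one -> x = ffun_one /\ y = ffun_one.
Proof.
move=> /ffunP xy1; have u i : x i = mone /\ y i = mone.
  by apply: unitm; have := xy1 i; rewrite !ffunE.
by split; apply/ffunP => i; rewrite ffunE; have [] := u i.
Qed.

HB.instance Definition _ := Choice_isMonomialDef.Build {ffun I -> K}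
  ffun_mulA ffun_mul1m ffun_mulm1 ffun_unitm.
End ProductMonoids.

Lemma eq_lincomb (R : pzRingType) (V : lmodType R) c (x x' y y' : V) :
  x = x' -> y = y' -> c *: x + y = c *: x' + y'.
Proof. by move=> -> ->. Qed.

Section LinearExtension.
Variables (C : comNzRingType) (K : choiceType).

Definition linext (V : lmodType C) (h : K -> V) (x : {malg C[K]}) : V :=
  \sum_(k <- msupp x) x@_k *: h k.

Lemma linextEw (V : lmodType C) (h : K -> V) (d : {fset K}) x :
  (msupp x `<=` d)%fset -> linext h x = \sum_(k <- d) x@_k *: h k.
Proof.
move=> le; rewrite [LHS](big_fset_incl _ le) => //= k kd /mcoeff_outdom ->.
by rewrite scale0r.
Qed.

Lemma linext_is_linear (V : lmodType C) (h : K -> V) : linear (linext h).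
Proof.
move=> c x y; set d := (msupp x `|` msupp y `|` msupp (c *: x + y))%fset.
rewrite !(@linextEw _ _ d); first last.
- exact: fsubsetUr.
- by rewrite /d -fsetUA fsubsetUl.
- by rewrite /d fsetUAC fsubsetUr.
rewrite scaler_sumr -big_split; apply: eq_bigr => k _ /=.
by rewrite mcoeffD mcoeffZ scalerDl scalerA.
Qed.

HB.instance Definition _ (V : lmodType C) (h : K -> V) :=
  GRing.isLinear.Build C {malg C[K]} V *:%R (linext h) (linext_is_linear h).

Lemma linextP (V : lmodType C) (h : K -> V) c x y :
  linext h (c *: x + y) = c *: linext h x + linext h y.
Proof. exact: linext_is_linear. Qed.

Lemma linextU (V : lmodType C) (h : K -> V) k : linext h << k >> = h k.
Proof. by rewrite (linextEw _ msuppU_le) big_seq_fset1 mcoeffUU scale1r. Qed.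

Definition fext (h : K -> C) (x : {malg C[K]}) : C :=
  \sum_(k <- msupp x) x@_k * h k.

Lemma fext_is_linear (h : K -> C) : linear_for *%R (fext h).
Proof. exact: (@linext_is_linear C^o h). Qed.

HB.instance Definition _ (h : K -> C) :=
  GRing.isLinear.Build C {malg C[K]} C *%R (fext h) (fext_is_linear h).

Lemma fextU (h : K -> C) k : fext h << k >> = h k.
Proof. exact: (@linextU C^o). Qed.

Lemma malgUZ (c : C) (k : K) : << c *g k >> = c *: << k >> :> {malg C[K]}.
Proof. by apply/malgP => i; rewrite mcoeffZ !mcoeffU mulr_natr. Qed.

Lemma malg_ind (P : {malg C[K]} -> Prop) :
    P 0 -> (forall k, P << k >>) ->
    (forall c x y, P x -> P y -> P (c *: x + y)) ->
  forall x, P x.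
Proof.
move=> P0 PU PD x; rewrite [x]monalgE; elim: (msupp x : seq K) => [|k s IH].
  by rewrite big_nil.
by rewrite big_cons malgUZ; apply: PD.
Qed.

Lemma linear_malg_eq (V : lmodType C) (f g : {linear {malg C[K]} -> V}) :
  (forall k, f << k >> = g << k >>) -> forall x, f x = g x.
Proof.
move=> fg; apply: malg_ind => [|//|c x y xE yE]; first by rewrite !linear0.
by rewrite !linearP xE yE.
Qed.

Lemma scalar_malg_eq (f g : {scalar {malg C[K]}}) :
  (forall k, f << k >> = g << k >>) -> forall x, f x = g x.
Proof.
move=> fg; apply: malg_ind => [|//|c x y xE yE]; first by rewrite !linear0.
by rewrite !linearP xE yE.
Qed.
End LinearExtension.

Section MonoidAlgebra.
Variables (C : comNzRingType) (K : monomType).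
Implicit Types x y : {malg C[K]}.

Lemma malgUM (k l : K) : << k >> * << l >> = << mmul k l >> :> {malg C[K]}.
Proof. by rewrite malgM_def fgmulUU mulr1. Qed.

Lemma malg_scalerAr c x y : c *: (x * y) = x * (c *: y).
Proof.
rewrite malgME (malgMEw (fsubset_refl _) (msuppZ_le c y)) scaler_sumr.
apply: eq_bigr => k _; rewrite scaler_sumr; apply: eq_bigr => l _.
by rewrite mcoeffZ [LHS]/= [in LHS]malgUZ scalerA [in RHS]malgUZ mulrCA.
Qed.

End MonoidAlgebra.

Section AntilinearExtension.
Variables (C : numClosedFieldType) (K : monomType).
Implicit Types x y : {malg C[K]}.

(* The antilinear extension of the involution s of the monoid K. *)
Definition mstar (s : K -> K) x : {malg C[K]} :=
  \sum_(k <- msupp x) << (x@_k)^* *g s k >>.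

Lemma mstarEw (s : K -> K) (d : {fset K}) x :
  (msupp x `<=` d)%fset -> mstar s x = \sum_(k <- d) << (x@_k)^* *g s k >>.
Proof.
move=> le; rewrite [LHS](big_fset_incl _ le) => //= k kd /mcoeff_outdom ->.
by rewrite rmorph0 monalgU0.
Qed.

Lemma mstarP (s : K -> K) c x y :
  mstar s (c *: x + y) = c^* *: mstar s x + mstar s y.
Proof.
set d := (msupp x `|` msupp y `|` msupp (c *: x + y))%fset.
rewrite !(@mstarEw s d); first last.
- exact: fsubsetUr.
- by rewrite /d -fsetUA fsubsetUl.
- by rewrite /d fsetUAC fsubsetUr.
rewrite scaler_sumr -big_split; apply: eq_bigr => k _ /=.
rewrite mcoeffD mcoeffZ rmorphD rmorphM monalgUD; congr (_ + _).
by rewrite malgUZ [in RHS]malgUZ scalerA.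
Qed.

Lemma mstar0 s : mstar s 0 = 0.
Proof. by rewrite /mstar msupp0 big_seq_fset0. Qed.

Lemma mstarD s x y : mstar s (x + y) = mstar s x + mstar s y.
Proof. by have := mstarP s 1 x y; rewrite rmorph1 !scale1r. Qed.

Lemma mstarZ s c x : mstar s (c *: x) = c^* *: mstar s x.
Proof. by have := mstarP s c x 0; rewrite mstar0 !addr0. Qed.

Lemma mstarN s x : mstar s (- x) = - mstar s x.
Proof. by rewrite -scaleN1r mstarZ rmorphN rmorph1 scaleN1r. Qed.

Lemma mstarU s k : mstar s << k >> = << s k >>.
Proof. by rewrite (mstarEw _ msuppU_le) big_seq_fset1 mcoeffUU rmorph1. Qed.

Lemma mstarM s : {morph s : k l / mmul k l >-> mmul l k} ->
  forall x y, mstar s (x * y) = mstar s y * mstar s x.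
Proof.
move=> sM x y; elim/malg_ind: x => [|k|c x z xE zE].
- by rewrite mul0r mstar0 mulr0.
- elim/malg_ind: y => [|l|c y z yE zE]; first by rewrite mulr0 mstar0 mul0r.
    by rewrite malgUM !mstarU malgUM sM.
  by rewrite mulrDr -malg_scalerAr !mstarP yE zE mulrDl scalerAl.
- by rewrite mulrDl -scalerAl !mstarP xE zE mulrDr malg_scalerAr.
Qed.

Lemma mstarK s : involutive s -> involutive (mstar s).
Proof.
move=> sK; apply: malg_ind => [|k|c x y xE yE]; first by rewrite !mstar0.
  by rewrite !mstarU sK.
by rewrite !mstarP conjCK xE yE.
Qed.
End AntilinearExtension.

Section FreeAlgebra.
Variables (C : comNzRingType) (L : choiceType) (K : monomType).

Definition letter (a : L) : {malg C[{fmonom L}]} := << fmu a >>.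

Lemma letterM (a : L) (w : {fmonom L}) :
  letter a * << w >> = << FMonom (a :: w) >>.
Proof. by rewrite malgUM; congr (<< _ >>); apply: val_inj; rewrite /= fmM fmU. Qed.

Lemma fmonom1E : << FMonom (Nil L) >> = 1 :> {malg C[{fmonom L}]}.
Proof. by congr (<< _ >>); apply: val_inj; rewrite /= fm1. Qed.

Definition alghom (h : L -> {malg C[K]}) :
    {malg C[{fmonom L}]} -> {malg C[K]} :=
  linext (fun w : {fmonom L} => \prod_(a <- w) h a).

HB.instance Definition _ h := GRing.Linear.on (alghom h).

Lemma alghomU h w : alghom h << w >> = \prod_(a <- w) h a.
Proof. exact: linextU. Qed.

Lemma alghom_letter h a : alghom h (letter a) = h a.
Proof. by rewrite alghomU fmU big_seq1. Qed.

Lemma alghomP h c x y :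
  alghom h (c *: x + y) = c *: alghom h x + alghom h y.
Proof. exact: linextP. Qed.

Lemma alghom0 h : alghom h 0 = 0.
Proof. exact: linear0. Qed.

Lemma alghom_is_multiplicative h : monoid_morphism (alghom h).
Proof.
split=> [|x y]; first by rewrite alghomU fm1 big_nil.
elim/malg_ind: x => [|k|c x z xE zE].
- by rewrite mul0r alghom0 mul0r.
- elim/malg_ind: y => [|l|c y z yE zE]; first by rewrite mulr0 alghom0 mulr0.
    rewrite malgUM [LHS]alghomU fmM big_cat.
    by congr (_ * _); rewrite alghomU.
  rewrite mulrDr -malg_scalerAr [LHS]alghomP [X in _ = _ * X]alghomP.
  rewrite [RHS]mulrDr -malg_scalerAr.
  exact: eq_lincomb yE zE.
- rewrite mulrDl -scalerAl [LHS]alghomP [X in _ = X * _]alghomP.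
  rewrite [RHS]mulrDl -scalerAl.
  exact: eq_lincomb xE zE.
Qed.

HB.instance Definition _ h :=
  GRing.isMonoidMorphism.Build {malg C[{fmonom L}]} {malg C[K]} (alghom h)
    (alghom_is_multiplicative h).

Lemma alghom1 h : alghom h 1 = 1.
Proof. exact: (alghom_is_multiplicative h).1. Qed.

Lemma alghomM h x y : alghom h (x * y) = alghom h x * alghom h y.
Proof. exact: (alghom_is_multiplicative h).2. Qed.

Definition fmstar (s : L -> L) (w : {fmonom L}) : {fmonom L} :=
  FMonom (rev [seq s a | a <- w]).

Lemma fmstarM s : {morph fmstar s : k l / mmul k l >-> mmul l k}.
Proof.
by move=> k l; apply: val_inj; rewrite /= !fmM map_cat rev_cat.
Qed.

Lemma fmstarK s : involutive s -> involutive (fmstar s).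
Proof.
by move=> sK w; apply: val_inj; rewrite /= map_rev revK mapK.
Qed.
End FreeAlgebra.

Lemma alghom_star (C : numClosedFieldType) (L : choiceType) (K : monomType)
    (h : L -> {malg C[K]}) (s : L -> L) (s' : K -> K) :
    {morph s' : k l / mmul k l >-> mmul l k} -> s' mone = mone ->
    (forall a, h (s a) = mstar s' (h a)) ->
  forall x, alghom h (mstar (fmstar s) x) = mstar s' (alghom h x).
Proof.
move=> sM s1 hs; apply: malg_ind => [|w|c x y xE yE].
- by rewrite mstar0 alghom0 mstar0.
- rewrite mstarU !alghomU /=; elim: (w : seq L) => [|a u IH].
    by rewrite !big_nil mstarU s1.
  rewrite map_cons rev_cons -cats1 big_cat big_seq1 big_cons (mstarM sM) hs.
  by congr (_ * _).
- rewrite [X in alghom h X]mstarP [LHS]alghomP [X in _ = mstar _ X]alghomP.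
  rewrite [RHS]mstarP.
  exact: eq_lincomb xE yE.
Qed.

Section Tensors.
Variables (C : comNzRingType) (K1 K2 K : monomType) (I : finType).

Definition tens (x : {malg C[K1]}) (y : {malg C[K2]}) :
    {malg C[(K1 * K2)%type]} :=
  linext (fun k => linext (fun l => << (k, l) >>) y) x.

Lemma tensU k l : tens << k >> << l >> = << (k, l) >>.
Proof. by rewrite /tens !linextU. Qed.

Lemma tensPl c x x' y : tens (c *: x + x') y = c *: tens x y + tens x' y.
Proof. exact: linearP. Qed.

Lemma tensPr c x y y' : tens x (c *: y + y') = c *: tens x y + tens x y'.
Proof.
rewrite /tens /linext scaler_sumr -big_split; apply: eq_bigr => k _ /=.
by rewrite -!/(linext _ _) linearP scalerDr !scalerA mulrC.
Qed.

Lemma tens0l y : tens 0 y = 0.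
Proof. exact: linear0. Qed.

Lemma tens0r x : tens x 0 = 0.
Proof. by have := tensPr (-1) x 0 0; rewrite !scaleN1r oppr0 addr0 addNr. Qed.

Lemma tensM x x' y y' : tens x y * tens x' y' = tens (x * x') (y * y').
Proof.
elim/malg_ind: x => [|k|c x z xE zE]; first by rewrite !(mul0r, tens0l).
  elim/malg_ind: y => [|l|c y z yE zE]; first by rewrite !(mul0r, tens0r).
    elim/malg_ind: x' => [|k'|c x z xE zE]; first by rewrite !(mulr0, tens0l).
      elim/malg_ind: y' => [|l'|c y z yE zE].
      - by rewrite !(mulr0, tens0r).
      - by rewrite !(tensU, malgUM).
      rewrite [X in _ * X]tensPr [X in _ = tens _ X]mulrDr.
      rewrite -[in RHS]malg_scalerAr [RHS]tensPr [LHS]mulrDr -[in LHS]malg_scalerAr.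
      exact: eq_lincomb yE zE.
    rewrite [X in _ * X]tensPl [X in _ = tens X _]mulrDr.
    rewrite -[in RHS]malg_scalerAr [RHS]tensPl [LHS]mulrDr -[in LHS]malg_scalerAr.
    exact: eq_lincomb xE zE.
  rewrite [X in X * _]tensPr [X in _ = tens _ X]mulrDl.
  rewrite -[in RHS]scalerAl [RHS]tensPr [LHS]mulrDl -[in LHS]scalerAl.
  exact: eq_lincomb yE zE.
rewrite [X in X * _]tensPl [X in _ = tens X _]mulrDl.
rewrite -[in RHS]scalerAl [RHS]tensPl [LHS]mulrDl -[in LHS]scalerAl.
exact: eq_lincomb xE zE.
Qed.

Definition tens_scalar (f : {scalar {malg C[K1]}}) (g : {scalar {malg C[K2]}}) :
    {scalar {malg C[(K1 * K2)%type]}} :=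
  fext (fun k : K1 * K2 => f << k.1 >> * g << k.2 >>).

Lemma tens_scalarE f g x y : tens_scalar f g (tens x y) = f x * g y.
Proof.
elim/malg_ind: x => [|k|c x z xE zE].
- by rewrite tens0l !linear0 mul0r.
- elim/malg_ind: y => [|l|c y z yE zE]; first by rewrite tens0r !linear0 mulr0.
    by rewrite tensU /tens_scalar /= fextU.
  rewrite [X in tens_scalar f g X]tensPr [LHS](linearP (tens_scalar f g)) [X in _ = _ * X](linearP g) /=.
  rewrite [RHS]mulrDr [X in _ = X + _]mulrCA.
  by congr (c * _ + _).
- rewrite [X in tens_scalar f g X]tensPl [LHS](linearP (tens_scalar f g)) [X in _ = X * _](linearP f) /=.
  rewrite [RHS]mulrDl -[X in _ = X + _]mulrA.
  by congr (c * _ + _).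
Qed.

Definition bigtens_scalar (f : I -> {scalar {malg C[K]}}) :
    {scalar {malg C[{ffun I -> K}]}} :=
  fext (fun k : {ffun I -> K} => \prod_i f i << k i >>).
End Tensors.

Section TensorStar.
Variables (C : numClosedFieldType) (K1 K2 : monomType).

Definition pairstar (s1 : K1 -> K1) (s2 : K2 -> K2) (k : K1 * K2) : K1 * K2 :=
  (s1 k.1, s2 k.2).

Lemma mstar_tens s1 s2 x y :
  mstar (pairstar s1 s2) (tens x y : {malg C[(K1 * K2)%type]}) = tens (mstar s1 x) (mstar s2 y).
Proof.
elim/malg_ind: x => [|k|c x z xE zE]; first by rewrite !(tens0l, mstar0).
  elim/malg_ind: y => [|l|c y z yE zE]; first by rewrite !(tens0r, mstar0).
    by rewrite !(mstarU, tensU).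
  rewrite [X in mstar _ X]tensPr [LHS]mstarP [X in _ = tens _ X]mstarP [RHS]tensPr.
  exact: eq_lincomb yE zE.
rewrite [X in mstar _ X]tensPl [LHS]mstarP [X in _ = tens X _]mstarP [RHS]tensPl.
exact: eq_lincomb xE zE.
Qed.
End TensorStar.

Section FreeProduct.
Variables (C : comNzRingType) (I : choiceType) (L : choiceType).

(* The embedding of the i-th factor into the free product of copies, indexed
   by I, of the free algebra on L. *)
Definition copy (i : I) :
    {malg C[{fmonom L}]} -> {malg C[{fmonom (I * L)%type}]} :=
  alghom (fun a => letter C (i, a)).

HB.instance Definition _ i := GRing.Linear.on (copy i).
HB.instance Definition _ i := GRing.RMorphism.on (copy i).

Lemma copy1 i : copy i 1 = 1.
Proof. exact: alghom1. Qed.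

Lemma copyM i x y : copy i (x * y) = copy i x * copy i y.
Proof. exact: alghomM. Qed.

Lemma copyP i c x y : copy i (c *: x + y) = c *: copy i x + copy i y.
Proof. exact: alghomP. Qed.
End FreeProduct.

Section BooleanExtension.
Variables (C : comNzRingType) (L : choiceType).
Implicit Types (phi : {scalar {malg C[{fmonom L}]}}) (u : seq L).
Implicit Types w : seq (option L).

(* In the alphabet option L, None is the letter t. *)
Definition tvar : {malg C[{fmonom (option L)}]} := letter C None.
Definition embt : {malg C[{fmonom L}]} -> {malg C[{fmonom (option L)}]} :=
  alghom (fun a => letter C (Some a)).

(* The words delimited by the occurrences of t. *)
Fixpoint runs (w : seq (option L)) : seq (seq L) :=
  match w with
  | [::] => [:: [::]]
  | None :: w' => [::] :: runs w'
  | Some a :: w' => (a :: head [::] (runs w')) :: behead (runs w')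
  end.

Definition boolext phi : {scalar {malg C[{fmonom (option L)}]}} :=
  fext (fun w : {fmonom (option L)} =>
          \prod_(u <- runs w | u != [::]) phi << FMonom u >>).

Lemma boolextU phi w : boolext phi << FMonom w >> =
  \prod_(u <- runs w | u != [::]) phi << FMonom u >>.
Proof. exact: fextU. Qed.

Lemma tvarXE r : tvar ^+ r = << FMonom (nseq r None) >>.
Proof.
elim: r => [|r IH]; first by rewrite expr0 -fmonom1E.
by rewrite exprS IH letterM.
Qed.

Lemma embtU u : embt << FMonom u >> = << FMonom (map Some u) >>.
Proof.
rewrite /embt alghomU /=; elim: u => [|a u IH]; first by rewrite big_nil fmonom1E.
by rewrite big_cons IH letterM.
Qed.

Lemma malg_catE w w' : << FMonom w >> * << FMonom w' >> = << FMonom (w ++ w') >>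
  :> {malg C[{fmonom (option L)}]}.
Proof. by rewrite malgUM; congr (<< _ >>); apply: val_inj; rewrite /= fmM. Qed.

Lemma boolext_nseq phi r w :
  boolext phi << FMonom (nseq r None ++ w) >> = boolext phi << FMonom w >>.
Proof.
by rewrite 2!boolextU; elim: r => //= r <-; rewrite big_cons eqxx.
Qed.

Lemma boolext_word phi u : u != [::] ->
  boolext phi << FMonom (map Some u) >> = phi << FMonom u >>.
Proof.
have -> : boolext phi << FMonom (map Some u) >> =
    \prod_(v <- [:: u] | v != [::]) phi << FMonom v >>.
  rewrite boolextU; congr (\big[_/_]_(_ <- _ | _) _).
  by elim: u => //= a u ->.
by move=> u0; rewrite big_cons big_nil u0 mulr1.
Qed.

Lemma boolext_cat phi u w : u != [::] ->
  boolext phi << FMonom (map Some u ++ None :: w) >> =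
  phi << FMonom u >> * boolext phi << FMonom w >>.
Proof.
move=> u0; rewrite 2!boolextU.
have -> : runs (map Some u ++ None :: w) = u :: runs w.
  by elim: u {u0} => //= a u ->.
by rewrite big_cons u0.
Qed.

Lemma boolextX phi r : boolext phi (tvar ^+ r) = 1.
Proof.
rewrite tvarXE -[nseq _ _]cats0 boolext_nseq boolextU /=.
by rewrite big_cons big_nil eqxx.
Qed.

Lemma boolextE phi r0 (s : seq (seq L * nat)) u r :
    all (fun p => (p.1 != [::]) && (0 < p.2)%N) s -> u != [::] ->
  boolext phi (tvar ^+ r0 *
    \prod_(p <- rcons s (u, r)) (embt << FMonom p.1 >> * tvar ^+ p.2)) =
  \prod_(p <- rcons s (u, r)) phi << FMonom p.1 >>.
Proof.
move=> sP u0; pose W := flatten [seq map Some p.1 ++ nseq p.2 None | p <- s].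
have -> : \prod_(p <- rcons s (u, r)) (embt << FMonom p.1 >> * tvar ^+ p.2) =
    << FMonom (W ++ map Some u ++ nseq r None) >>.
  rewrite {}/W {sP}; elim: s => [|p s IH] /=.
    by rewrite big_seq1 embtU tvarXE malg_catE.
  by rewrite big_cons IH embtU tvarXE !malg_catE -!catA.
rewrite tvarXE malg_catE boolext_nseq {}/W.
elim: s sP => [_|[v [|k]] s IH] /=; last 2 first.
- by rewrite andbF.
- rewrite andbT => /andP[v0 /IH sE].
  by rewrite -!catA /= boolext_cat // big_cons boolext_nseq sE.
rewrite big_seq1 /=; case: r => [|r]; first by rewrite cats0 boolext_word.
rewrite (boolext_cat phi (nseq r None) u0).
by have := boolextX phi r; rewrite tvarXE => ->; rewrite mulr1.
Qed.
End BooleanExtension.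

(* The letters of the free *-algebra generated by G: (a, false) is a and
   (a, true) is a^*. *)
Definition sletter (G : choiceType) := (G * bool)%type.
HB.instance Definition _ (G : choiceType) := Choice.on (sletter G).

Notation freestar C G := {malg C[{fmonom (sletter G)}]}.
Notation freestar_t C G := {malg C[{fmonom (option (sletter G))}]}.
(* The m-fold free product of freestar_t C G; the copies are numbered from 0. *)
Notation freestar_tm C G m :=
  {malg C[{fmonom ('I_m * option (sletter G))%type}]}.
Notation freestar_tm2 C G m :=
  {malg C[({fmonom ('I_m * option (sletter G))%type}
         * {fmonom ('I_m * option (sletter G))%type})%type]}.
Notation freestar_tensm C G m :=
  {malg C[{ffun 'I_m -> {fmonom (option (sletter G))}}]}.

Section Involutions.
Variables (C : numClosedFieldType) (G : choiceType) (m : nat).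

Definition sl_star (a : sletter G) : sletter G := (a.1, ~~ a.2).
Definition tml_star (x : 'I_m * option (sletter G)) :=
  (x.1, omap sl_star x.2).

Lemma sl_starK : involutive sl_star.
Proof. by case=> a b; rewrite /sl_star /= negbK. Qed.
Lemma tml_starK : involutive tml_star.
Proof. by case=> i [[a b]|] //=; rewrite /tml_star /= /sl_star /= negbK. Qed.

Definition fs_star : freestar C G -> freestar C G := mstar (fmstar sl_star).
Definition tm_star : freestar_tm C G m -> freestar_tm C G m :=
  mstar (fmstar tml_star).
Definition tm2_star : freestar_tm2 C G m -> freestar_tm2 C G m :=
  mstar (pairstar (fmstar tml_star) (fmstar tml_star)).

Definition is_state (phi : {scalar freestar C G}) : Prop :=
  phi 1 = 1 /\ forall x, 0 <= phi (x * fs_star x).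
End Involutions.

Section Coproduct.
Variables (C : numClosedFieldType) (G : choiceType) (m : nat).

Definition t_ (i : 'I_m) : freestar_tm C G m := letter C (i, None).

(* a_(k), which is 0 when k is not the number of a copy. *)
Definition a_ (a : sletter G) (k : nat) : freestar_tm C G m :=
  oapp (fun i : 'I_m => letter C (i, Some a)) 0 (insub k).

(* The product of t_(j) over the copies j >= k, in increasing order. *)
Definition tfrom (k : nat) : freestar_tm C G m := \prod_(j < m | (k <= j)%N) t_ j.

Definition Delta_diff (a : G) (k : nat) : freestar_tm2 C G m :=
  let d := a_ (a, false) k - a_ (a, false) k.+1 in
  tens d (tfrom k) + tens (tfrom k) d.

(* a_(k) is the telescoping sum of the a_(j) - a_(j+1) for j >= k; the value
   at a starred letter is forced by compatibility with the involution. *)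
Definition Delta_letter (x : 'I_m * option (sletter G)) : freestar_tm2 C G m :=
  match x with
  | (i, None) => tens (t_ i) (t_ i)
  | (i, Some (a, b)) =>
      let d := \sum_(j < m | (i <= j)%N) Delta_diff a j in
      if b then tm2_star d else d
  end.

Definition Delta : freestar_tm C G m -> freestar_tm2 C G m :=
  alghom Delta_letter.

HB.instance Definition _ := GRing.Linear.on Delta.
HB.instance Definition _ := GRing.RMorphism.on Delta.

Lemma Delta_t i : Delta (t_ i) = tens (t_ i) (t_ i).
Proof. exact: alghom_letter. Qed.

Lemma Delta_aB (a : G) (k : 'I_m) :
  Delta (a_ (a, false) k - a_ (a, false) k.+1) =
  tens (a_ (a, false) k - a_ (a, false) k.+1) (tfrom k) +
  tens (tfrom k) (a_ (a, false) k - a_ (a, false) k.+1).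
Proof.
have Da (i : nat) : Delta (a_ (a, false) i) =
    \sum_(j < m | (i <= j)%N) Delta_diff a j.
  rewrite {1}/a_; case: insubP => [j _ <-|]; first exact: alghom_letter.
  rewrite -leqNgt => im /=; rewrite rmorph0 big_pred0 // => j.
  by rewrite leqNgt (leq_trans (ltn_ord j) im).
have -> x y : Delta (x - y) = Delta x - Delta y by exact: rmorphB.
rewrite !Da (bigD1 k) //=.
rewrite [X in _ + X - _](eq_bigl (fun j : 'I_m => (k < j)%N)) ?addrK // => j.
by rewrite ltn_neqAle andbC eq_sym.
Qed.

Lemma Delta_star x : Delta (tm_star x) = tm2_star (Delta x).
Proof.
apply: alghom_star => [k l||[i [[a b]|]]].
- by rewrite /pairstar /= !fmstarM.
- by congr (_, _); apply: val_inj; rewrite /= !fm1.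
- rewrite /= /tm2_star; case: b => //=; rewrite mstarK // => k.
  by case: k => k l; rewrite /pairstar /= !fmstarK //; exact: tml_starK.
- rewrite /= mstar_tens mstarU.
  suff -> : fmstar (@tml_star G m) (fmu (i, None)) = fmu (i, None) by [].
  by apply: val_inj; rewrite /= fmU.
Qed.
End Coproduct.

Section Convolution.
Variables (C : numClosedFieldType) (G : choiceType).

Definition convolution m (f g : {scalar freestar_tm C G m}) :
    {scalar freestar_tm C G m} :=
  (tens_scalar f g \o @Delta C G m).

Definition eta m : freestar_tm C G m -> freestar_tensm C G m :=
  alghom (fun x => << [ffun j => if j == x.1 then fmu x.2 else mone] >>).

HB.instance Definition _ m := GRing.Linear.on (@eta m).
HB.instance Definition _ m := GRing.RMorphism.on (@eta m).

Lemma eta_copy m (i : 'I_m) (w : {fmonom (option (sletter G))}) :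
  eta (copy i << w >>) = << [ffun j => if j == i then w else mone] >>.
Proof.
case: w => w; rewrite /copy alghomU /=; elim: w => [|a w IH].
  rewrite big_nil rmorph1; congr (<< _ >>); apply/ffunP => j; rewrite !ffunE.
  by case: eqP => // _; apply: val_inj; rewrite /= fm1.
rewrite big_cons; have -> x y : eta (x * y) = eta x * eta y by exact: alghomM.
rewrite IH /eta alghom_letter malgUM; congr (<< _ >>).
apply/ffunP => j; rewrite !ffunE; case: eqP => _; last by rewrite mul1m.
by apply: val_inj; rewrite /= fmM fmU.
Qed.

Definition Phi_tilde m (phi psi : {scalar freestar C G}) :
    {scalar freestar_tensm C G m} :=
  bigtens_scalar (fun i : 'I_m => boolext (if val i == 0%N then phi else psi)).

Definition Phi_hat m (phi psi : {scalar freestar C G}) :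
    {scalar freestar_tm C G m} :=
  (Phi_tilde m phi psi \o @eta m).

Definition i1hat m : freestar C G -> freestar_tm C G m.+1 :=
  alghom (fun a => letter C (ord0, Some a)).
End Convolution.

Section CFree.
Variables (C : comNzRingType) (L : choiceType).

(* For unital psi i, these conditions determine Phi among linear functionals
   (is_cfree_product_uniq), and a solution exists when the phi i are unital too
   (is_cfree_product_exists); so positivity of Phi is not required here. *)
Definition is_cfree_product (I : choiceType)
    (phi psi : I -> {scalar {malg C[{fmonom L}]}})
    (Phi : {scalar {malg C[{fmonom (I * L)%type}]}}) : Prop :=
  Phi 1 = 1 /\
  forall s : seq (I * {malg C[{fmonom L}]}),
    sorted (fun p q => p.1 != q.1) s -> {in s, forall p, psi p.1 p.2 = 0} ->
    Phi (\prod_(p <- s) copy p.1 p.2) = \prod_(p <- s) phi p.1 p.2.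

Lemma is_cfree_product_uniq (I : choiceType)
    (phi psi : I -> {scalar {malg C[{fmonom L}]}})
    (Phi Phi' : {scalar {malg C[{fmonom (I * L)%type}]}}) :
    (forall i, psi i 1 = 1) ->
    is_cfree_product phi psi Phi -> is_cfree_product phi psi Phi' ->
  forall x, Phi x = Phi' x.
Proof.
move=> psi1 [_ PhiE] [_ Phi'E].
pose P (s : seq (I * {malg C[{fmonom L}]})) := \prod_(p <- s) copy p.1 p.2.
suff E s : Phi (P s) = Phi' (P s).
  apply: scalar_malg_eq => -[w].
  have := E [seq (p.1, letter C p.2) | p <- w]; rewrite /P big_map /=.
  suff -> : \prod_(p <- w) copy p.1 (letter C p.2) =
    << FMonom w >> :> {malg C[{fmonom (I * L)%type}]} by [].
  elim: w => [|[i a] w IH]; first by rewrite big_nil fmonom1E.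
  by rewrite big_cons IH /copy alghom_letter letterM.
have Pcat s1 s2 : P (s1 ++ s2) = P s1 * P s2 by exact: big_cat.
have Pcons i x s1 : P ((i, x) :: s1) = copy i x * P s1 by exact: big_cons.
have [n] := ubnP (size s); elim: n s => // n IHn s.
rewrite ltnS => sn.
have [ss|] := boolP (sorted (fun i j => i != j) (unzip1 s)); last first.
  have merge i x y s1 s2 :
      P (s1 ++ [:: (i, x), (i, y) & s2]) = P (s1 ++ (i, x * y) :: s2).
    rewrite !Pcat !Pcons [X in _ = _ * (X * _)]copyM -[X in _ = _ * X]mulrA.
    by [].
  have aux q s1 : ~~ path (fun i j => i != j) q.1 (unzip1 s1) ->
      exists s2 i x y s3, q :: s1 = s2 ++ [:: (i, x), (i, y) & s3].
    elim: s1 q => //= -[j y] s1 IH [i x] /=; rewrite negb_and negbK.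
    have [<- _|_ /= /(IH (j, y)) [s2 [k [x' [y' [s3 ->]]]]]] := eqVneq i j.
      by exists [::], i, x, y, s1.
    by exists ((i, x) :: s2), k, x', y', s3.
  case: s sn => // q s1 sn /= /aux [s2 [i [x [y [s3 E]]]]].
  rewrite E merge; apply: IHn; move: sn; rewrite E !size_cat /= !addnS.
  exact: leq_trans.
suff H (r c : seq (I * {malg C[{fmonom L}]})) :
    {in c, forall p, psi p.1 p.2 = 0} -> (size (c ++ r) <= n)%N ->
    sorted (fun i j => i != j) (unzip1 (c ++ r)) ->
    Phi (P (c ++ r)) = Phi' (P (c ++ r)) by exact: (H s [::]).
have srt t : sorted (fun p q => p.1 != q.1) t =
    sorted (fun i j => i != j) (unzip1 t) by rewrite sorted_map.
elim: r c => [|[i a] r IH] c cs cn ct.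
  by move: cn ct; rewrite cats0 => _ ct; rewrite PhiE ?Phi'E ?srt.
pose a0 := a - psi i a *: 1.
have -> : P (c ++ (i, a) :: r) = psi i a *: P (c ++ r) + P (rcons c (i, a0) ++ r).
  rewrite cat_rcons 3!Pcat 2!Pcons; move: (P c) (P r) => X Y.
  have -> : copy i a = psi i a *: 1 + copy i a0 :> {malg C[{fmonom (I * L)%type}]}.
    by rewrite -(@copy1 C I L i) -copyP addrC subrK.
  have e (c1 y : {malg C[{fmonom (I * L)%type}]}) (d : C) :
      (d *: 1 + c1) * y = d *: y + c1 * y by rewrite mulrDl -scalerAl mul1r.
  by rewrite e mulrDr -malg_scalerAr.
rewrite [LHS](linearP Phi) [RHS](linearP Phi') /=.
congr (_ * _ + _).
  apply: IHn; apply: leq_trans cn; by rewrite !size_cat /= addnS.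
apply: IH.
- move=> p; rewrite mem_rcons inE => /predU1P[->|/cs //] /=.
  by rewrite /a0 linearB linearZ /= psi1 mulr1 subrr.
- by rewrite cat_rcons; move: cn; rewrite !size_cat.
- by move: ct; rewrite cat_rcons /unzip1 !map_cat.
Qed.

Definition delta : {malg C[{fmonom L}]} -> {malg C[{fmonom (bool * L)%type}]} :=
  alghom (fun a => letter C (false, a) + letter C (true, a)).
End CFree.

Lemma lincombACA (R : comNzRingType) (V : lmodType R) (c d : R) (x y z t : V) :
  c *: (d *: x + y) + (d *: z + t) = d *: (c *: x + z) + (c *: y + t).
Proof. by rewrite !scalerDr !scalerA [d * c]mulrC addrACA. Qed.

Lemma lincomb_split (R : pzRingType) (V : lmodType R) (c d e : R) (x y z : V) :
  c *: (d *: x + y) + (e *: x + z) = (c * d + e) *: x + (c *: y + z).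
Proof. by rewrite scalerDl scalerDr scalerA addrACA. Qed.

Lemma scaleNKr (R : pzRingType) (V : lmodType R) (c : R) (x y : V) :
  c *: x + (- c *: x + y) = y.
Proof. by rewrite addrA -scalerDl subrr scale0r add0r. Qed.

Section CFreeExists.
Variables (C : comNzRingType) (L I : choiceType).
Variables phi psi : I -> {scalar {malg C[{fmonom L}]}}.
Hypotheses (phi1 : forall i, phi i 1 = 1) (psi1 : forall i, psi i 1 = 1).

(* The free product acts on the span of formal tensors of words, the word u
   in position i standing for the centred element u - psi i u; the functional
   cf_eps of the vector x . [::] is the conditionally free product at x. *)
Let V := {malg C[seq (I * {fmonom L})]}.
Let A := {malg C[{fmonom L}]}.
Let F := {malg C[{fmonom (I * L)%type}]}.

Definition cf_new (i : I) (a : L) (r : seq (I * {fmonom L})) : V :=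
  psi i (letter C a) *: << r >> + << (i, fmu a) :: r >>.

Definition cf_op_word (l : I * L) (r : seq (I * {fmonom L})) : V :=
  if r is (j, u) :: r' then
    if j == l.1 then
      (- psi j << u >>) *: cf_new l.1 l.2 r' +
      (psi j << mmul (fmu l.2) u >> *: << r' >> +
        << (j, mmul (fmu l.2) u) :: r' >>)
    else cf_new l.1 l.2 r
  else cf_new l.1 l.2 r.

Definition cf_op (l : I * L) : V -> V := linext (cf_op_word l).
Definition cf_act_word (w : seq (I * L)) (v : V) : V := foldr cf_op v w.
Definition cf_act (x : F) (v : V) : V :=
  linext (fun w : {fmonom (I * L)%type} => cf_act_word w v) x.
Definition cf_eps : V -> C :=
  fext (fun r => \prod_(p <- r) (phi p.1 << p.2 >> - psi p.1 << p.2 >>)).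
Definition cf_cons (i : I) (u : {fmonom L}) (r : seq (I * {fmonom L})) : V :=
  if u == mone then 0 else << (i, u) :: r >>.
Definition cf_ins (i : I) (x : A) (v : V) : V :=
  linext (fun u => linext (cf_cons i u) v) x.

Lemma cf_act_wordP w c v v' :
  cf_act_word w (c *: v + v') = c *: cf_act_word w v + cf_act_word w v'.
Proof. by elim: w => //= l w ->; exact: linextP. Qed.

Lemma cf_actPr x c v v' :
  cf_act x (c *: v + v') = c *: cf_act x v + cf_act x v'.
Proof.
rewrite /cf_act /linext scaler_sumr -big_split; apply: eq_bigr => w _ /=.
by rewrite cf_act_wordP scalerDr !scalerA mulrC.
Qed.

Lemma cf_actPl x y c v :
  cf_act (c *: x + y) v = c *: cf_act x v + cf_act y v.
Proof. exact: linextP. Qed.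

Lemma cf_actr0 x : cf_act x 0 = 0.
Proof. by have := cf_actPr x (-1) 0 0; rewrite scaler0 addr0 scaleN1r addNr. Qed.

Lemma cf_actl0 v : cf_act 0 v = 0.
Proof. exact: linear0. Qed.

Lemma cf_actU w v : cf_act << w >> v = cf_act_word w v.
Proof. exact: linextU. Qed.

Lemma cf_act1 v : cf_act 1 v = v.
Proof. by rewrite cf_actU fm1. Qed.

Lemma cf_act_letter l y v :
  cf_act (letter C l * y) v = cf_op l (cf_act y v).
Proof.
elim/malg_ind: y => [|w|c x y xE yE].
- by rewrite mulr0 cf_actl0; symmetry; exact: linear0.
- by rewrite malgUM 2!cf_actU fmM fmU.
- rewrite mulrDr -malg_scalerAr cf_actPl [X in _ = cf_op l X]cf_actPl.
  by rewrite [RHS]linextP; exact: eq_lincomb xE yE.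
Qed.

Lemma cf_actM x y v : cf_act (x * y) v = cf_act x (cf_act y v).
Proof.
elim/malg_ind: x => [|[w]|c x z xE zE].
- by rewrite mul0r 2!cf_actl0.
- elim: w => [|l w IH]; first by rewrite fmonom1E mul1r cf_act1.
  have -> : << FMonom (l :: w) >> = letter C l * << FMonom w >>.
    by rewrite letterM.
  have -> : letter C l * << FMonom w >> * y = letter C l * (<< FMonom w >> * y).
    by symmetry; exact: mulrA.
  by rewrite [LHS]cf_act_letter [RHS]cf_act_letter IH.
- rewrite mulrDl -scalerAl cf_actPl [RHS]cf_actPl; exact: eq_lincomb xE zE.
Qed.

Lemma cf_insPl i c x y v :
  cf_ins i (c *: x + y) v = c *: cf_ins i x v + cf_ins i y v.
Proof. exact: linextP. Qed.

Lemma cf_insPr i x c v v' :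
  cf_ins i x (c *: v + v') = c *: cf_ins i x v + cf_ins i x v'.
Proof.
rewrite /cf_ins {1 3 5}/linext scaler_sumr -big_split; apply: eq_bigr => k _ /=.
by rewrite linextP scalerDr !scalerA mulrC.
Qed.

Lemma cf_ins_U i u r : cf_ins i << u >> << r >> = cf_cons i u r.
Proof. by rewrite /cf_ins 2!linextU. Qed.

Definition cf_good i (v : V) : Prop :=
  forall x, cf_act (copy i x) v = psi i x *: v + cf_ins i x v.

Lemma cf_good0 i : cf_good i 0.
Proof.
move=> x; rewrite cf_actr0 scaler0 add0r /cf_ins /linext big1 // => k _.
by rewrite msupp0 big_seq_fset0 scaler0.
Qed.

Lemma cf_goodP i c v v' : cf_good i v -> cf_good i v' -> cf_good i (c *: v + v').
Proof.
move=> gv gv' x; rewrite cf_actPr gv gv' cf_insPr; exact: lincombACA.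
Qed.

Lemma cf_good_linext i (K : choiceType) (h : K -> V) x :
  (forall k, cf_good i (h k)) -> cf_good i (linext h x).
Proof.
move=> gh; elim/malg_ind: x => [|k|c x y gx gy].
- by have -> : linext h 0 = 0 by [exact: linear0]; exact: cf_good0.
- by rewrite linextU; exact: gh.
- by rewrite linextP; exact: cf_goodP.
Qed.

Lemma cf_goodU i r : (if r is (j, u) :: r' then j != i else true) ->
  cf_good i << r >>.
Proof.
move=> ri; elim/malg_ind => [|[w]|c x y gx gy].
- have -> : copy i 0 = 0 :> F by exact: alghom0.
  by rewrite cf_actl0 linear0 scale0r add0r; symmetry; exact: linear0.
- elim: w => [|a w IH].
    rewrite fmonom1E copy1 cf_act1 psi1 scale1r.
    have -> : 1 = << mone >> :> A by [].
    by rewrite cf_ins_U /cf_cons eqxx addr0.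
  rewrite -(letterM C a (FMonom w)) copyM {1}/copy alghom_letter cf_act_letter IH.
  have opr : cf_op (i, a) << r >> = cf_new i a r.
    rewrite /cf_op linextU; case: r ri {IH} => [//|[j u] r] /= ji.
    by rewrite (negbTE ji).
  rewrite [LHS]linextP -/(cf_op _ _) opr letterM 2!cf_ins_U {1}/cf_cons.
  have -> : cf_cons i (FMonom (a :: w)) r = << (i, FMonom (a :: w)) :: r >>.
    by rewrite /cf_cons ifN // fmP fm1.
  have -> : FMonom (a :: w) = mmul (fmu a) (FMonom w).
    by apply: val_inj; rewrite /= fmM fmU.
  case: eqVneq => [->|_].
    have -> : psi i << mone >> = 1 by exact: psi1.
    rewrite mulm1 scale1r /cf_new -[RHS]addr0; congr (_ + _).
    exact: linear0.
  have -> : linext (cf_op_word (i, a)) << (i, FMonom w) :: r >> =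
      (- psi i << FMonom w >>) *: cf_new i a r +
      (psi i << mmul (fmu a) (FMonom w) >> *: << r >> +
        << (i, mmul (fmu a) (FMonom w)) :: r >>).
    by rewrite linextU /= eqxx.
  exact: scaleNKr.
- rewrite copyP cf_actPl cf_insPl [X in _ = X *: _ + _](linearP (psi i)) /=.
  by rewrite -lincomb_split; exact: eq_lincomb gx gy.
Qed.

Lemma cf_good_ins i j x v : j != i -> cf_good i (cf_ins j x v).
Proof.
move=> ji; apply: cf_good_linext => u; apply: cf_good_linext => r.
rewrite /cf_cons; case: eqP => _; first exact: cf_good0.
exact: cf_goodU.
Qed.

Lemma cf_epsP c v v' : cf_eps (c *: v + v') = c * cf_eps v + cf_eps v'.
Proof. exact: fext_is_linear. Qed.

Lemma cf_eps0 : cf_eps 0 = 0.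
Proof. exact: linear0. Qed.

Lemma cf_eps_ins i x v : cf_eps (cf_ins i x v) = (phi i x - psi i x) * cf_eps v.
Proof.
elim/malg_ind: x => [|u|c x y xE yE].
- have -> : cf_ins i 0 v = 0 by exact: linear0.
  by rewrite cf_eps0 !linear0 subrr mul0r.
- elim/malg_ind: v => [|r|c x y xE yE].
  + have -> : cf_ins i << u >> 0 = 0 by rewrite /cf_ins linextU; exact: linear0.
    by rewrite cf_eps0 mulr0.
  + rewrite cf_ins_U /cf_cons; case: eqP => [->|_].
      have -> : << mone >> = 1 :> A by [].
      by rewrite phi1 psi1 subrr mul0r cf_eps0.
    by rewrite /cf_eps 2!fextU big_cons.
  + rewrite cf_insPr [LHS]cf_epsP [X in _ = _ * X]cf_epsP.
    by rewrite mulrDr mulrCA; congr (_ * _ + _).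
- rewrite cf_insPl cf_epsP xE yE !linearP /=.
  by rewrite mulrA -mulrDl mulrBr addrACA opprD.
Qed.

Definition cf_Phi : {scalar F} :=
  fext (fun w : {fmonom (I * L)%type} => cf_eps (cf_act_word w << [::] >>)).

Lemma cf_PhiE x : cf_Phi x = cf_eps (cf_act x << [::] >>).
Proof.
elim/malg_ind: x => [|w|c x y xE yE].
- by rewrite cf_actl0 cf_eps0 linear0.
- by rewrite cf_actU; exact: fextU.
- by rewrite cf_actPl cf_epsP [LHS]linearP xE yE.
Qed.

Lemma is_cfree_product_exists : exists Phi, is_cfree_product phi psi Phi.
Proof.
exists cf_Phi; split.
  by rewrite cf_PhiE cf_act1 /cf_eps fextU big_nil.
move=> s; pose T := foldr (fun p v => cf_ins p.1 p.2 v) << [::] >> s.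
move=> ss s0.
have actT : cf_act (\prod_(p <- s) copy p.1 p.2) << [::] >> = T.
  rewrite {}/T; elim: s ss s0 => [_ _|[i x] s IH /= ss s0].
    by rewrite big_nil cf_act1.
  rewrite big_cons cf_actM IH; first last.
  - by move=> p ps; apply: s0; rewrite inE ps orbT.
  - exact: path_sorted ss.
  have g : cf_good i (foldr (fun p v => cf_ins p.1 p.2 v) << [::] >> s).
    case: s ss {IH s0} => [_|[j y] s /= /andP[ij _]]; first exact: cf_goodU.
    by apply: cf_good_ins; rewrite eq_sym.
  have -> := g x; have -> : psi i x = 0 by apply: (s0 (i, x)); rewrite mem_head.
  by rewrite scale0r add0r.
rewrite cf_PhiE actT {ss actT}/T; elim: s s0 => [_|[i x] s IH s0] /=.
  by rewrite big_nil /cf_eps fextU big_nil.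
rewrite cf_eps_ins big_cons IH; last first.
  by move=> p ps; apply: s0; rewrite inE ps orbT.
by have -> : psi i x = 0; [apply: (s0 (i, x)); rewrite mem_head | rewrite subr0].
Qed.
End CFreeExists.

(* Main.v *)
Require Import Defs.
From mathcomp Require Import all_boot all_order all_algebra finmap complex monalg.
From mathcomp Require Import all_classical all_reals all_analysis.

(** The convergence is stationary: on a given x the sequence is equal to its
    limit as soon as m is large enough.

    Write Theta for the tensor product of the two functionals Phi_hat.  It is
    a functional on an algebra with one site (s, j) for each side s of the
    tensor square and each stage j < m, and it is the product over the sites
    of Boolean extensions, of phi_s at stage 0 and of psi_s at the later ones.
    The coproduct of the first copy of a letter c is the sum over the two sides
    s of the elements
      J(c, s) = sum over j of (c_(s,j) - c_(s,j+1)) T_(s',j),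
    where s' is the other side and T_(s',j) is the product of the letters t at
    the sites (s', i) with i >= j.  So the sequence is Theta o J o delta for the
    homomorphism J on the free product, and it remains to compare Theta o J
    with the conditionally free product.  Both are linear, and alternating
    products of elements that the psi_s annihilate span the free product
    (alternating_centred_span), hence it suffices to compute
    Theta (J (y_1 ... y_n)) for such a product.

    Modulo the left kernel of Theta the letter t acts at its site as the
    rank one projection on the unit, since boolext phi (x t y) is
    boolext phi x * boolext phi y (boolext_t).  Let z be a product of local
    elements, with nothing on the side s' at the stages >= k, and with an
    element annihilated by the state at (s', k - 1).  Then T_(s',j) z is z for
    j >= k and 0 for j < k, so that the sum defining J(c, s) telescopes:
    J(y, s) z is congruent to y_(s,k) z (spread_copy_local_prod).

    Consequently the last factor y_n acts on the unit as y_n at stage 0, that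
    is, as the scalar phi y_n plus a remainder annihilated by phi at stage 0.
    Once such a remainder is present, y_(n-1) is inserted at stage 1 on the
    other side, y_(n-2) at stage 2, and so on: the stages are climbed one by
    one and nothing ever brings the remainder back to the unit, so Theta
    vanishes (spread_excited).  Only the scalar survives, and by induction the
    value is the product of the phi y_i (spread_alternating), which is the
    value of the conditionally free product.  The climb needs at most n stages,
    whence the bound on m. *)

Set Implicit Arguments.
Unset Strict Implicit.
Unset Printing Implicit Defensive.

Import Order.TTheory GRing.Theory Num.Theory numFieldNormedType.Exports.

Local Open Scope classical_set_scope.
Local Open Scope ring_scope.

(** * Alternating centred products span the free product *)

(** A word is built letter by letter, and the span of the alternating centred
    products is stable under left multiplication by a letter. *)
Lemma alternating_centred_span (C : comNzRingType) (L I : choiceType)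
    (psi : I -> {scalar {malg C[{fmonom L}]}}) (psi1 : forall i, psi i 1 = 1)
    (P : {malg C[{fmonom (I * L)%type}]} -> Prop) :
    P 0 -> (forall c x y, P x -> P y -> P (c *: x + y)) ->
    (forall s : seq (I * {malg C[{fmonom L}]}),
       sorted (fun p q => p.1 != q.1) s ->
       {in s, forall p, psi p.1 p.2 = 0} ->
       P (\prod_(p <- s) copy p.1 p.2)) ->
  forall x, P x.
Proof.
move=> P0 PD Ps.
(* P is generalized: the induction on words uses P (letter * _). *)
suff H w : forall P : {malg C[{fmonom (I * L)%type}]} -> Prop,
    P 0 -> (forall c x y, P x -> P y -> P (c *: x + y)) ->
    (forall s : seq (I * {malg C[{fmonom L}]}),
       sorted (fun p q => p.1 != q.1) s ->
       {in s, forall p, psi p.1 p.2 = 0} ->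
       P (\prod_(p <- s) copy p.1 p.2)) -> P << FMonom w >>.
  by apply: malg_ind => // -[w]; apply: H.
elim: w {P P0 PD Ps} => [|[i a] w IH] P P0 PD Ps.
  by have := Ps [::] isT; rewrite big_nil fmonom1E; apply.
rewrite -(letterM C (i, a) (FMonom w)); apply: (IH (fun y => P (letter C (i, a) * y))).
- by rewrite mulr0.
- by move=> c x y Px Py; rewrite mulrDr -malg_scalerAr; exact: PD.
move=> s ss s0.
(* A letter of the i-th copy multiplies the first factor when this factor is
   in the i-th copy, and is a new first factor otherwise; the centring of the
   first factor so obtained leaves a multiple of the remaining product. *)
have PC x s' : sorted (fun p q => p.1 != q.1) ((i, x) :: s') ->
    {in s', forall p, psi p.1 p.2 = 0} ->
    P (copy i x * \prod_(p <- s') copy p.1 p.2).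
  move=> ss' s'0; pose x0 := x - psi i x *: 1.
  have -> : copy i x = psi i x *: 1 + copy i x0 :> {malg C[{fmonom (I * L)%type}]}.
    by rewrite -(@copy1 C I L i) -copyP addrC subrK.
  rewrite mulrDl -scalerAl mul1r; apply: PD.
    by apply: Ps => //; exact: path_sorted ss'.
  have := Ps ((i, x0) :: s'); rewrite big_cons; apply.
    by case: (s') ss'.
  move=> p; rewrite inE => /predU1P[->|/s'0 //] /=.
  by rewrite /x0 linearB linearZ /= psi1 mulr1 subrr.
have E : letter C (i, a) = copy i (letter C a) by rewrite /copy alghom_letter.
rewrite {}E; case: s ss s0 => [_ _|[j y] s ss s0]; first exact: PC.
case: (eqVneq i j) ss s0 => [<-|ij] ss s0.
  rewrite big_cons mulrA -copyM; apply: PC => [|p ps]; first by case: (s) ss.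
  by apply: s0; rewrite inE ps orbT.
by apply: PC => //; apply/andP.
Qed.

(** * The Boolean extension factors at each letter t *)

Lemma malg_mulPl (C : comNzRingType) (K : monomType) c (x y z : {malg C[K]}) :
  (c *: x + y) * z = c *: (x * z) + y * z.
Proof. by rewrite mulrDl -scalerAl. Qed.

Lemma malg_mulPr (C : comNzRingType) (K : monomType) c (x y z : {malg C[K]}) :
  z * (c *: x + y) = c *: (z * x) + z * y.
Proof. by rewrite mulrDr -malg_scalerAr. Qed.

Lemma lincomb_mulr (C : comNzRingType) (a c x x' y y' : C) :
  x = a * x' -> y = a * y' -> c * x + y = a * (c * x' + y').
Proof. by move=> -> ->; rewrite mulrDr mulrCA. Qed.

Lemma lincomb_mull (C : comNzRingType) (a c x x' y y' : C) :
  x = x' * a -> y = y' * a -> c * x + y = (c * x' + y') * a.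
Proof. by move=> -> ->; rewrite mulrDl mulrA. Qed.

Section Boolext.
Variables (C : comNzRingType) (L : choiceType).
Variable phi : {scalar {malg C[{fmonom L}]}}.

Lemma runs_cat (w w' : seq (option L)) :
  runs (w ++ None :: w') = runs w ++ runs w'.
Proof.
elim: w => //= -[a|] w -> //=.
(* head and behead only see the first factor of the concatenation. *)
have : runs w != [::] by case: w => [|[]].
by case: (runs w).
Qed.

(** In a representation, t is the rank one projection on the cyclic vector. *)
Lemma boolext_t x y :
  boolext phi (x * tvar C L * y) = boolext phi x * boolext phi y.
Proof.
elim/malg_ind: x => [|[w]|c x z xE zE].
- by rewrite !mul0r linear0 mul0r.
- elim/malg_ind: y => [|[w']|c y z yE zE]; first by rewrite mulr0 linear0 mulr0.
    have -> : tvar C L = << FMonom [:: None] >>.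
      by rewrite -(expr1 (tvar C L)) tvarXE.
    by rewrite !malg_catE !boolextU -catA runs_cat big_cat.
  rewrite malg_mulPr [LHS](linearP (boolext phi)) [in RHS](linearP (boolext phi)) /=.
  exact: lincomb_mulr.
- rewrite !malg_mulPl [LHS](linearP (boolext phi)) [in RHS](linearP (boolext phi)) /=.
  exact: lincomb_mull.
Qed.

Lemma boolext1 : boolext phi 1 = 1.
Proof. exact: (boolextX phi 0). Qed.

Lemma boolext_emb x : phi 1 = 1 -> boolext phi (embt x) = phi x.
Proof.
move=> phi1; elim/malg_ind: x => [|[u]|c x y xE yE].
- by rewrite linear0 [X in boolext phi X]alghom0 linear0.
- rewrite embtU; have [->|u0] := eqVneq u [::]; last exact: boolext_word.
  by rewrite [<< FMonom [::] >> in LHS]fmonom1E boolext1 fmonom1E phi1.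
- rewrite [X in boolext phi X]alghomP [LHS](linearP (boolext phi)) /=.
  by rewrite [RHS](linearP phi) /=; congr (_ * _ + _).
Qed.
End Boolext.

(** * Functionals that are products over sites *)

Section Sites.
Variables (C : comNzRingType) (L : choiceType) (Q : finType) (K : monomType).
(** K is a monoid of words in letters attached to the sites q : Q; site q
    extracts the subword at q and gen q o is the letter o placed at q. *)
Variables (site : Q -> K -> {fmonom (option L)}) (gen : Q -> option L -> K).
Hypothesis site1 : forall q, site q mone = mone.
Hypothesis siteM : forall q, {morph site q : k l / mmul k l}.
Hypothesis site_gen : forall q q' o,
  site q (gen q' o) = if q' == q then fmu o else mone.
Variable b : Q -> {scalar {malg C[{fmonom (option L)}]}}.
Variable Theta : {scalar {malg C[K]}}.
Hypothesis ThetaU : forall k, Theta << k >> = \prod_q b q << site q k >>.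

Definition at_site (q : Q) : {malg C[{fmonom (option L)}]} -> {malg C[K]} :=
  alghom (fun o => << gen q o >>).

(** The factors at different sites are not assumed to commute in K; they do
    in the eyes of Theta, by Theta_local below. *)
Definition local_prod (l : seq (Q * {malg C[{fmonom (option L)}]})) :=
  \prod_(p <- l) at_site p.1 p.2.

Definition content q (l : seq (Q * {malg C[{fmonom (option L)}]})) :=
  \prod_(p <- l | p.1 == q) p.2.

Lemma at_siteU q w : exists2 k, at_site q << w >> = << k >> &
  forall q', site q' k = if q == q' then w else mone.
Proof.
case: w => w; rewrite /at_site alghomU /=; elim: w => [|o w [k kE sk]].
  exists mone; first by rewrite big_nil.
  move=> q'; rewrite site1; case: eqP => // _.
  by apply: val_inj; rewrite /= fm1.
exists (mmul (gen q o) k); first by rewrite big_cons kE malgUM.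
move=> q'; rewrite siteM sk site_gen; case: eqP => _; last by rewrite mul1m.
by apply: val_inj; rewrite /= fmM fmU.
Qed.

Lemma local_prod_cons q x l :
  local_prod ((q, x) :: l) = at_site q x * local_prod l.
Proof. exact: big_cons. Qed.

Lemma local_prod_cat l l' : local_prod (l ++ l') = local_prod l * local_prod l'.
Proof. exact: big_cat. Qed.

Lemma content_cons q q' x l :
  content q ((q', x) :: l) = if q' == q then x * content q l else content q l.
Proof. exact: big_cons. Qed.

Lemma content_cat q l l' : content q (l ++ l') = content q l * content q l'.
Proof. exact: big_cat. Qed.

(** On words this is the product formula for Theta, and both sides are linear
    in each factor of l. The word k in front is what lets this formula control
    congruences. *)
Lemma Theta_local k l : Theta (<< k >> * local_prod l) =
  \prod_q b q (<< site q k >> * content q l).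
Proof.
elim: l k => [|[q x] l IH] k.
  rewrite /local_prod big_nil mulr1 ThetaU; apply: eq_bigr => q _.
  by rewrite /content big_nil mulr1.
pose r := \prod_(q' | q' != q) b q' (<< site q' k >> * content q' l).
have split_q y : \prod_q' b q' (<< site q' k >> * content q' ((q, y) :: l)) =
    b q (<< site q k >> * (y * content q l)) * r.
  have -> : r = \prod_(q' | true && (q' != q))
      b q' (<< site q' k >> * content q' ((q, y) :: l)).
    by apply: eq_bigr => q'; rewrite eq_sym content_cons => /negbTE ->.
  by rewrite (bigD1 q isT) content_cons eqxx.
rewrite local_prod_cons; elim/malg_ind: x => [|w|c x y xE yE].
- rewrite [X in _ * (X * _)]alghom0 mul0r mulr0 linear0 split_q.
  by rewrite mul0r mulr0 linear0 mul0r.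
- have [j -> jE] := at_siteU q w.
  rewrite mulrA malgUM IH; apply: eq_bigr => q' _.
  rewrite content_cons siteM jE.
  case: eqP => _; last by rewrite mulm1.
  by rewrite [X in _ = b q' X]mulrA malgUM.
- rewrite [X in _ * (X * _)]alghomP malg_mulPl malg_mulPr.
  rewrite [LHS](linearP Theta) /= [RHS]split_q.
  rewrite malg_mulPl malg_mulPr [X in _ = X * _](linearP (b q)) /=.
  exact: lincomb_mull (etrans xE (split_q x)) (etrans yE (split_q y)).
Qed.

(** Congruence modulo the left ideal on which Theta degenerates: the equality
    of the vectors that z and z' represent in the GNS construction. *)
Definition cong z z' := forall y, Theta (y * z) = Theta (y * z').

Lemma cong_words z z' : (forall k, Theta (<< k >> * z) = Theta (<< k >> * z')) ->
  cong z z'.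
Proof.
move=> zz'; apply: malg_ind => [|//|c x y xE yE].
  by rewrite !mul0r.
rewrite !malg_mulPl [LHS](linearP Theta) [RHS](linearP Theta) /=.
by congr (_ * _ + _).
Qed.

Lemma cong_trans z' z z'' : cong z z' -> cong z' z'' -> cong z z''.
Proof. by move=> zz' z'z'' y; rewrite zz'. Qed.

Lemma cong_mull x z z' : cong z z' -> cong (x * z) (x * z').
Proof. by move=> zz' y; rewrite 2!mulrA; exact: zz'. Qed.

Lemma congP c x y x' y' :
  cong x x' -> cong y y' -> cong (c *: x + y) (c *: x' + y').
Proof.
move=> xx' yy' z; rewrite !malg_mulPr [LHS](linearP Theta) [RHS](linearP Theta).
by congr (_ * _ + _); [exact: xx' | exact: yy'].
Qed.

Lemma cong_sum (I : Type) (r : seq I) (F F' : I -> {malg C[K]}) :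
  (forall i, cong (F i) (F' i)) -> cong (\sum_(i <- r) F i) (\sum_(i <- r) F' i).
Proof.
move=> FF'; elim: r => [|i r IH]; first by rewrite !big_nil.
rewrite !big_cons -[F i]scale1r -[F' i]scale1r; exact: congP.
Qed.

Lemma cong_local l l' :
  (forall q x, b q (x * content q l) = b q (x * content q l')) ->
  cong (local_prod l) (local_prod l').
Proof.
by move=> ll'; apply: cong_words => k; rewrite 2!Theta_local; apply: eq_bigr.
Qed.

Lemma cong_local0 q l : (forall x, b q (x * content q l) = 0) ->
  cong (local_prod l) 0.
Proof.
move=> l0; apply: cong_words => k; rewrite mulr0 linear0 Theta_local.
by rewrite (bigD1 q) //= l0 mul0r.
Qed.
End Sites.

(** * The spreading of a letter over the stages *)

Section Spread.
Variables (C : comNzRingType) (L : choiceType) (m : nat) (K : monomType).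
Local Notation Q := (bool * 'I_m.+1)%type.
Variables (site : Q -> K -> {fmonom (option L)}) (gen : Q -> option L -> K).
Hypothesis site1 : forall q, site q mone = mone.
Hypothesis siteM : forall q, {morph site q : k l / mmul k l}.
Hypothesis site_gen : forall q q' o,
  site q (gen q' o) = if q' == q then fmu o else mone.
Variables phi psi : bool -> {scalar {malg C[{fmonom L}]}}.
Hypotheses (phi1 : forall s, phi s 1 = 1) (psi1 : forall s, psi s 1 = 1).
Variable Theta : {scalar {malg C[K]}}.

Definition stage_state (q : Q) : {scalar {malg C[{fmonom L}]}} :=
  if val q.2 == 0%N then phi q.1 else psi q.1.

Hypothesis ThetaU : forall k,
  Theta << k >> = \prod_q boolext (stage_state q) << site q k >>.

(** The order of the letters t in T_(s,j), a parameter because the involution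
    reverses it for the starred letters. *)
Variable ord : L -> seq 'I_m.+1.
Hypotheses (ord_uniq : forall c, uniq (ord c)) (mem_ord : forall c i, i \in ord c).

Local Notation at_ := (@at_site C L Q K gen).
Local Notation lprod := (@local_prod C L Q K gen).
Local Notation "x ~~~ y" := (cong Theta x y) (at level 70).

(** The value 0 past the last stage makes the telescoping sums end with a
    single letter. *)
Definition stage_letter s c (j : nat) : {malg C[K]} :=
  oapp (fun i : 'I_m.+1 => at_ (s, i) (letter C (Some c))) 0 (insub j).

Definition vacua s c (j : nat) : {malg C[K]} :=
  \prod_(i <- ord c | (j <= i)%N) at_ (s, i) (tvar C L).

(** The part on the side a.1 of the coproduct of the first copy of the letter
    a.2. *)
Definition spread_letter (a : bool * L) : {malg C[K]} :=
  \sum_(j < m.+1)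
    (stage_letter a.1 a.2 j - stage_letter a.1 a.2 j.+1) * vacua (~~ a.1) a.2 j.

Definition spread := alghom spread_letter.

Implicit Types l : seq (Q * {malg C[{fmonom (option L)}]}).

(** For the vector represented by l, empty_from and centred_below say that the
    stages of the side s from k on are in the vacuum state, and that stage
    k - 1 is orthogonal to the vacuum; for k = 0 the latter is void. *)
Definition empty_from (s : bool) (k : nat) l :=
  forall i : 'I_m.+1, (k <= i)%N -> content (s, i) l = 1.

Definition centred_below (s : bool) (k : nat) l :=
  forall i : 'I_m.+1, i.+1 = k ->
    boolext (stage_state (s, i)) (content (s, i) l) = 0.

Lemma stage_state1 q : stage_state q 1 = 1.
Proof. by rewrite /stage_state; case: ifP. Qed.

(** The products of a noncommutative ring cannot be reordered, but only one
    factor is attached to each site. *)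
Lemma content_vacua (q : Q) (s : bool) c j :
  content q [seq ((s, i), tvar C L) | i : 'I_m.+1 <- ord c & (j <= i)%N] =
  if (q.1 == s) && (j <= q.2)%N then tvar C L else 1.
Proof.
case: q => s' i /=; rewrite /content big_map big_filter_cond /=.
rewrite (eq_bigl (fun i' => (s' == s) && (j <= i)%N && (i' == i))); last first.
  move=> i'; rewrite xpair_eqE (eq_sym s); case: (i' =P i) => [->|_].
    by rewrite !andbT andbC.
  by rewrite !andbF.
case: ifP => _; last by rewrite big_pred0.
by rewrite -big_filter (filter_pred1_uniq (ord_uniq c) (mem_ord c i)) big_seq1.
Qed.

(** For j < k the product of letters t contains the one at stage k - 1, which
    projects a centred element to 0; for k <= j it only meets stages in the
    vacuum state, which it fixes. *)
Lemma vacua_local_prod s c k l (j : nat) :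
  (k <= m.+1)%N -> empty_from s k l -> centred_below s k l ->
  vacua s c j * lprod l ~~~ if (k <= j)%N then lprod l else 0.
Proof.
move=> km e0 c0.
have -> : vacua s c j =
    lprod [seq ((s, i), tvar C L) | i : 'I_m.+1 <- ord c & (j <= i)%N].
  by rewrite /local_prod big_map big_filter.
rewrite -local_prod_cat; case: leqP => [kj|jk].
  apply: (cong_local site1 siteM site_gen ThetaU) => -[s' i] x.
  rewrite content_cat content_vacua; case: ifP => [/andP[/= /eqP-> ji]|_].
    rewrite (e0 i (leq_trans kj ji)) [x * 1]mulr1 mulrA boolext_t.
    by rewrite boolext1 mulr1.
  by rewrite [1 * _]mul1r.
case: k => // k in jk km e0 c0 *.
apply: (cong_local0 site1 siteM site_gen ThetaU (q := (s, Ordinal km))) => x.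
rewrite content_cat content_vacua /= eqxx -ltnS jk mulrA boolext_t.
by rewrite (c0 (Ordinal km)) // mulr0.
Qed.

Lemma stage_telescope s c k : (k <= m)%N ->
  \sum_(j < m.+1 | (k <= j)%N) (stage_letter s c j - stage_letter s c j.+1) =
  at_ (s, inord k) (letter C (Some c)).
Proof.
move=> km.
rewrite -(big_mkord (fun j => (k <= j)%N)
  (fun j => stage_letter s c j - stage_letter s c j.+1)).
rewrite (big_cat_nat (n := k)) //=; last exact: ltnW.
rewrite big_nat_cond big_pred0 ?add0r; last first.
  by move=> j /=; case: ltngtP => //; rewrite andbF.
rewrite big_nat_cond (eq_bigl (fun j => (k <= j < m.+1)%N && true)); last first.
  by move=> j; case: (k <= j)%N; rewrite ?andbT ?andbF.
rewrite -big_nat_cond; under eq_bigr do rewrite -opprB.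
rewrite sumrN telescope_sumr; last exact: leqW.
rewrite /stage_letter insubF ?ltnn // (insubT (fun i => i < m.+1)%N km) /=.
rewrite sub0r opprK; congr (at_ (_, _) _); apply: val_inj.
by rewrite /= inordK.
Qed.

Lemma spread_letter_local_prod s c k l :
  (k <= m)%N -> empty_from (~~ s) k l -> centred_below (~~ s) k l ->
  spread_letter (s, c) * lprod l ~~~ at_ (s, inord k) (letter C (Some c)) * lprod l.
Proof.
move=> km e0 c0; rewrite /spread_letter mulr_suml /=.
apply: (@cong_trans _ _ _ (\sum_(j < m.+1)
    (stage_letter s c j - stage_letter s c j.+1) *
    (if (k <= j)%N then lprod l else 0))).
  apply: cong_sum => j; rewrite -mulrA; apply: cong_mull.
  by apply: vacua_local_prod => //; exact: leqW.
move=> y; congr (Theta (y * _)); rewrite -(stage_telescope s c km) mulr_suml.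
by rewrite [RHS]big_mkcond /=; apply: eq_bigr => j _; case: ifP; rewrite ?mulr0.
Qed.

(** Letter by letter: what is already at (s, k) is not seen by the letters t,
    which are on the other side. *)
Lemma spread_copy_local_prod s x k l :
  (k <= m)%N -> empty_from (~~ s) k l -> centred_below (~~ s) k l ->
  spread (copy s x) * lprod l ~~~ lprod (((s, inord k), embt x) :: l).
Proof.
move=> km e0 c0; rewrite local_prod_cons.
elim/malg_ind: x => [|[u]|c x y xE yE].
- have -> : spread (copy s 0) = 0 by rewrite [copy s 0]alghom0; exact: alghom0.
  have -> : at_ (s, inord k) (embt 0) = 0.
    by rewrite [embt 0]alghom0; exact: alghom0.
  by rewrite !mul0r.
- elim: u => [|a u IH].
    rewrite fmonom1E copy1; have -> : spread 1 = 1 by exact: alghom1.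
    have -> : at_ (s, inord k) (embt 1) = 1.
      by rewrite [embt 1]alghom1; exact: alghom1.
    by [].
  rewrite -(letterM C a (FMonom u)) copyM.
  have -> : spread (copy s (letter C a) * copy s << FMonom u >>) =
      spread_letter (s, a) * spread (copy s << FMonom u >>).
    rewrite [LHS]alghomM; congr (_ * _).
    by rewrite /copy alghom_letter; exact: alghom_letter.
  have -> : at_ (s, inord k) (embt (letter C a * << FMonom u >>)) =
      at_ (s, inord k) (letter C (Some a)) *
      at_ (s, inord k) (embt << FMonom u >>).
    rewrite [embt _]alghomM [LHS]alghomM; congr (_ * _).
    by rewrite alghom_letter.
  rewrite -2!mulrA; apply: cong_trans (cong_mull _ IH) _.
  have := @spread_letter_local_prod s a k
    (((s, inord k), embt << FMonom u >>) :: l) km.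
  rewrite local_prod_cons; apply=> i ki; rewrite content_cons.
    by case: eqP => [[]|_]; [case: (s) | exact: e0].
  by case: eqP => [[]|_]; [case: (s) | exact: c0].
- have -> : spread (copy s (c *: x + y)) =
      c *: spread (copy s x) + spread (copy s y).
    by rewrite copyP; exact: alghomP.
  have -> : at_ (s, inord k) (embt (c *: x + y)) =
      c *: at_ (s, inord k) (embt x) + at_ (s, inord k) (embt y).
    by rewrite [embt _]alghomP; exact: alghomP.
  rewrite malg_mulPl [X in cong _ _ X]malg_mulPl.
  exact: congP xE yE.
Qed.

(** A vector whose top stage is orthogonal to the vacuum stays so: each factor
    of the alternating product puts a centred element on the next stage, on
    the other side. At the end the top stage is a factor 0 of Theta. *)
Lemma spread_excited s top k l :
  path (fun i j => i != j) top (rev (unzip1 s)) ->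
  {in s, forall p, psi p.1 p.2 = 0} -> (0 < k)%N -> (k + size s <= m.+1)%N ->
  (forall s, empty_from s k l) -> centred_below top k l ->
  Theta (spread (\prod_(p <- s) copy p.1 p.2) * lprod l) = 0.
Proof.
elim/last_ind: s top k l => [|s [i x] IH] top [//|k] l /= alt s0 _ km e0 c0.
  rewrite big_nil [X in X * _]alghom1.
  rewrite (Theta_local site1 siteM site_gen ThetaU mone l).
  have km' : (k < m.+1)%N by rewrite -(addn0 k.+1).
  rewrite (bigD1 (top, Ordinal km')) //= site1 [<< mone >> * _]mul1r.
  by rewrite (c0 (Ordinal km')) // mul0r.
rewrite size_rcons addnS in km.
move: alt; rewrite /unzip1 map_rcons rev_rcons /= => /andP[ti alt].
(* There are two sides only, so the last factor faces the excited side. *)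
have tE : top = ~~ i by case: (top) (i) ti => [] [].
rewrite big_rcons /= [X in X * _]alghomM -mulrA.
have km' : (k.+1 <= m)%N by rewrite ltnS in km; exact: leq_trans (leq_addr _ _) km.
rewrite (spread_copy_local_prod x km') -?tE //.
apply: (IH i k.+2) => //.
- by move=> p ps; apply: s0; rewrite mem_rcons inE ps orbT.
- by move=> s' j kj; rewrite content_cons ifN ?e0 // 1?ltnW //;
  rewrite xpair_eqE negb_and; apply/orP; right;
  apply/eqP => jE; rewrite -jE inordK ?ltnn in kj.
move=> j [jE]; rewrite content_cons.
have -> : j = inord k.+1 by apply: val_inj; rewrite /= inordK.
rewrite eqxx e0 ?inordK // mulr1 boolext_emb ?stage_state1 //.
rewrite /stage_state /= inordK //=.
by apply: (s0 (i, x)); rewrite mem_rcons mem_head.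
Qed.

(** The last factor acts on the vacuum at stage 0, where the state is phi: it
    contributes its expectation and a centred part, which spread_excited
    kills. *)
Lemma spread_alternating s :
  sorted (fun p q => p.1 != q.1) s -> {in s, forall p, psi p.1 p.2 = 0} ->
  (size s <= m.+1)%N ->
  Theta (spread (\prod_(p <- s) copy p.1 p.2)) = \prod_(p <- s) phi p.1 p.2.
Proof.
(* Factors act from right to left, hence the induction on the last one. *)
have -> : sorted (fun p q => p.1 != q.1) s =
    sorted (fun i j => i != j) (rev (unzip1 s)).
  rewrite rev_sorted sorted_map; apply: eq_sorted => p q /=.
  by rewrite eq_sym.
elim/last_ind: s => [|s [i x] IH] alt s0 sm.
  rewrite !big_nil [X in Theta X]alghom1 ThetaU big1 // => q _.
  by rewrite site1; exact: boolext1.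
rewrite /unzip1 map_rcons rev_rcons /= in alt; rewrite size_rcons in sm.
rewrite !big_rcons /= -[spread _]mulr1 [X in X * _]alghomM -mulrA.
have e0 s' : empty_from s' 0 [::] by move=> j _; rewrite /content big_nil.
have := @spread_copy_local_prod i x 0 [::] (leq0n m) (e0 _).
rewrite {1}/local_prod big_nil => -> //.
have [x0 xE phi_x0] : exists2 x0, x = phi i x *: 1 + x0 & phi i x0 = 0.
  exists (x - phi i x *: 1); first by rewrite addrC subrK.
  by rewrite linearB linearZ /= phi1 mulr1 subrr.
have -> : lprod [:: (i, inord 0, embt x)] =
    phi i x *: 1 + lprod [:: (i, inord 0, embt x0)].
  have [g [gE g1 gP]] : exists g : _ -> {malg C[K]},
      [/\ forall y, lprod [:: (i, inord 0, embt y)] = g y, g 1 = 1 &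
          forall c y z, g (c *: y + z) = c *: g y + g z].
    exists (fun y => at_ (i, inord 0) (embt y)); split=> [y||c y z].
    - by rewrite /local_prod big_seq1.
    - by rewrite [embt 1]alghom1; exact: alghom1.
    - by rewrite [embt _]alghomP; exact: alghomP.
  by rewrite [LHS]gE [X in _ = _ + X]gE {1}xE gP g1.
rewrite malg_mulPr mulr1 [LHS](linearP Theta) /= IH; first last.
- exact: ltnW.
- by move=> p ps; apply: s0; rewrite mem_rcons inE ps orbT.
- exact: path_sorted alt.
rewrite (@spread_excited _ i 1) //; first by rewrite addr0 mulrC.
- by move=> p ps; apply: s0; rewrite mem_rcons inE ps orbT.
- move=> s' j j0; rewrite content_cons ifN ?e0 //.
  by rewrite xpair_eqE negb_and; apply/orP; right;
  apply/eqP => jE; rewrite -jE inordK in j0.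
move=> j [jE]; rewrite content_cons.
have -> : j = inord 0 by apply: val_inj; rewrite /= inordK.
rewrite eqxx e0 // mulr1 boolext_emb ?stage_state1 //.
by rewrite /stage_state /= inordK.
Qed.
End Spread.

(** * The coproduct on the first copy as a spreading *)

Section TensorSquare.
Variables (C : numClosedFieldType) (G : choiceType) (m : nat).
Local Notation L := (sletter G).
Local Notation Q := (bool * 'I_m.+1)%type.
Local Notation word := {fmonom ('I_m.+1 * option L)%type}.

Definition subword (i : 'I_m.+1) (w : word) : {fmonom (option L)} :=
  FMonom [seq p.2 | p <- w & p.1 == i].

Definition tsite (q : Q) (k : word * word) : {fmonom (option L)} :=
  subword q.2 (if q.1 then k.2 else k.1).

Definition tgen (q : Q) (o : option L) : (word * word)%type :=
  if q.1 then (mone, fmu (q.2, o)) else (fmu (q.2, o), mone).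

Lemma subword1 i : subword i mone = mone.
Proof. by apply: val_inj; rewrite /= !fm1. Qed.

Lemma subwordM i : {morph subword i : k l / mmul k l}.
Proof.
by move=> k l; apply: val_inj; rewrite /= !fmM filter_cat map_cat.
Qed.

Lemma subword_letter i j o : subword i (fmu (j, o)) = if j == i then fmu o else mone.
Proof.
by apply: val_inj; rewrite /= fmU /=; case: eqP => _; rewrite ?fmU ?fm1.
Qed.

Lemma tsite1 q : tsite q mone = mone.
Proof. by case: q => [[] i]; exact: subword1. Qed.

Lemma tsiteM q : {morph tsite q : k l / mmul k l}.
Proof. by case: q => [[] i] k l; exact: subwordM. Qed.

Lemma tsite_gen q q' o : tsite q (tgen q' o) = if q' == q then fmu o else mone.
Proof.
case: q q' => [[] i] [[] j]; rewrite /tsite /tgen /= ?subword1 // subword_letter.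
  by [].
by [].
Qed.

Lemma eta_word (w : word) :
  eta << w >> = << [ffun i => subword i w] >> :> freestar_tensm C G m.+1.
Proof.
case: w => w; rewrite /eta alghomU /=; elim: w => [|[i o] w IH].
  rewrite big_nil; congr (<< _ >>); apply/ffunP => j; rewrite !ffunE.
  by apply: val_inj; rewrite /= fm1.
rewrite big_cons IH malgUM; congr (<< _ >>); apply/ffunP => j; rewrite !ffunE /=.
rewrite eq_sym /subword /=; case: eqP => _ /=; last by rewrite mul1m.
by apply: val_inj; rewrite /= fmM fmU.
Qed.

Lemma Phi_hat_word (phi psi : {scalar freestar C G}) (w : word) :
  Phi_hat m.+1 phi psi << w >> =
  \prod_i boolext (if val i == 0%N then phi else psi) << subword i w >>.
Proof.
have -> : Phi_hat m.+1 phi psi << w >> = Phi_tilde m.+1 phi psi (eta << w >>).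
  by [].
rewrite eta_word; apply: etrans (fextU _ _) _.
by apply: eq_bigr => i _; rewrite ffunE.
Qed.

(** The quotient eta only retains the subwords at the stages, so the tensor
    product of the two functionals is a product over sites. *)
Lemma tens_Phi_hat_word (phi psi : bool -> {scalar freestar C G}) k :
  tens_scalar (Phi_hat m.+1 (phi false) (psi false))
              (Phi_hat m.+1 (phi true) (psi true)) << k >> =
  \prod_q boolext (stage_state phi psi q) << tsite q k >>.
Proof.
apply: etrans (fextU _ _) _; rewrite 2!Phi_hat_word.
rewrite -(pair_bigA _ (fun (s : bool) (i : 'I_m.+1) =>
  boolext (stage_state phi psi (s, i)) << tsite (s, i) k >>)) /=.
by rewrite big_bool mulrC.
Qed.

(** The involution reverses the product of the letters t in the coproduct of a
    letter of G. *)
Definition star_order (c : L) : seq 'I_m.+1 :=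
  if c.2 then rev (index_enum 'I_m.+1) else index_enum 'I_m.+1.

Lemma star_order_uniq c : uniq (star_order c).
Proof. by rewrite /star_order; case: c.2; rewrite ?rev_uniq index_enum_uniq. Qed.

Lemma mem_star_order c i : i \in star_order c.
Proof. by rewrite /star_order; case: c.2; rewrite ?mem_rev mem_index_enum. Qed.

Local Notation spread_l := (spread_letter C tgen star_order).

Definition tleg (s : bool) (x y : freestar_tm C G m.+1) : freestar_tm2 C G m.+1 :=
  if s then tens y x else tens x y.

Definition tdiff (c : L) (j : nat) : freestar_tm C G m.+1 :=
  a_ C m.+1 c j - a_ C m.+1 c j.+1.

Definition tfrom_star (c : L) (j : nat) : freestar_tm C G m.+1 :=
  \prod_(i <- star_order c | (j <= i)%N) t_ C G i.

Lemma tens_bigr (r : seq 'I_m.+1) (P : pred 'I_m.+1) F :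
  \prod_(i <- r | P i) tens 1 (F i) =
  tens 1 (\prod_(i <- r | P i) F i) :> freestar_tm2 C G m.+1.
Proof.
elim: r => [|i r IH]; first by rewrite !big_nil tensU.
rewrite !big_cons; case: ifP => _; last exact: IH.
by rewrite IH tensM; congr (tens _ _); exact: mul1r.
Qed.

Lemma tens_bigl (r : seq 'I_m.+1) (P : pred 'I_m.+1) F :
  \prod_(i <- r | P i) tens (F i) 1 =
  tens (\prod_(i <- r | P i) F i) 1 :> freestar_tm2 C G m.+1.
Proof.
elim: r => [|i r IH]; first by rewrite !big_nil tensU.
rewrite !big_cons; case: ifP => _; last exact: IH.
by rewrite IH tensM; congr (tens _ _); exact: mul1r.
Qed.

Lemma at_site_letter s i o :
  at_site tgen (s, i) (letter C o) = tleg s (letter C (i, o)) 1.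
Proof. by rewrite /at_site alghom_letter; case: s; rewrite /= tensU. Qed.

Lemma stage_letterE s c j : stage_letter C tgen s c j = tleg s (a_ C m.+1 c j) 1.
Proof.
rewrite /stage_letter /a_; case: insubP => [i _ _|_] /=.
  by rewrite at_site_letter.
by case: s; rewrite /= ?tens0l ?tens0r.
Qed.

Lemma vacuaE s c j : vacua C tgen star_order s c j = tleg s (tfrom_star c j) 1.
Proof.
rewrite /vacua; under eq_bigr do rewrite at_site_letter.
by case: s; [exact: tens_bigr | exact: tens_bigl].
Qed.

Lemma tlegB s x x' y : tleg s (x - x') y = tleg s x y - tleg s x' y.
Proof.
by case: s; rewrite /= -scaleN1r addrC ?tensPl ?tensPr scaleN1r addrC.
Qed.

Lemma spread_letterE s c :
  spread_l (s, c) = \sum_(j < m.+1) tleg s (tdiff c j) (tfrom_star c j).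
Proof.
apply: eq_bigr => j _ /=; rewrite 2!stage_letterE vacuaE -tlegB.
by case: s; apply: etrans (tensM _ _ _ _) _; congr (tens _ _);
  [exact: mul1r | exact: mulr1 | exact: mulr1 | exact: mul1r].
Qed.

Lemma tm_star_tdiff a j : tm_star (tdiff (a, false) j) = tdiff (a, true) j.
Proof.
have aE k : tm_star (a_ C m.+1 (a, false) k) = a_ C m.+1 (a, true) k.
  rewrite /a_; case: insubP => [i _ _|_] /=; last exact: mstar0.
  rewrite /tm_star /letter mstarU; congr (<< _ >>); apply: val_inj.
  by rewrite /= fmU /= fmU.
by rewrite /tdiff /tm_star mstarD mstarN -!/(tm_star _) 2!aE.
Qed.

Lemma tm_star_tfrom a j : tm_star (tfrom C G m.+1 j) = tfrom_star (a, true) j.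
Proof.
rewrite /tfrom /tfrom_star /star_order /=.
elim: (index_enum _) => [|i r IH].
  rewrite !big_nil /tm_star mstarU; congr (<< _ >>); apply: val_inj.
  by rewrite /= !fm1.
rewrite big_cons rev_cons big_rcons /=; case: (j <= i)%N; last by rewrite mulr1.
rewrite [LHS](mstarM (@fmstarM _ _)) [X in X * _]IH; congr (_ * _).
rewrite /t_ /letter mstarU; congr (<< _ >>); apply: val_inj.
by rewrite /= fmU.
Qed.

Lemma Delta_letter_spread c :
  Delta_letter C (ord0 : 'I_m.+1, Some c) = spread_l (false, c) + spread_l (true, c).
Proof.
have DE b : Delta_letter C (ord0 : 'I_m.+1, Some (c.1, b)) =
    \sum_(j < m.+1) (if b then tm2_star (Delta_diff C m.+1 c.1 j)
                     else Delta_diff C m.+1 c.1 j).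
  case: b; last exact: eq_bigl.
  rewrite /= [LHS](big_morph (@tm2_star C G m.+1) (mstarD _) (mstar0 _ _)).
  exact: eq_bigl.
rewrite [c in LHS]surjective_pairing DE 2!spread_letterE -big_split.
apply: eq_bigr => j _; case: c {DE} => a [] /=; last by [].
have starD x y : tm2_star (x + y) = tm2_star x + tm2_star y :> freestar_tm2 C G m.+1.
  exact: mstarD.
have starT (x y : freestar_tm C G m.+1) :
    tm2_star (tens x y) = tens (tm_star x) (tm_star y) by rewrite /tm2_star mstar_tens.
have dE := tm_star_tdiff a j; have tE := tm_star_tfrom a j.
apply: etrans (starD _ _) _.
apply: (congr2 +%R); apply: etrans (starT _ _) _; apply: (congr2 (@tens _ _ _)).
- exact: dE.
- exact: tE.
- exact: tE.
- exact: dE.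
Qed.

Local Notation spreadm := (spread (C := C) tgen star_order).

(** delta splits a letter into its copies on the two sides, and the coproduct
    of the first copy splits accordingly. *)
Lemma Delta_i1hat x : Delta (i1hat m x) = spreadm (delta x).
Proof.
elim/malg_ind: x => [|[w]|c x y xE yE].
- rewrite [i1hat m 0]alghom0 [delta 0]alghom0 [LHS]alghom0; symmetry.
  exact: alghom0.
- elim: w => [|a w IH].
    rewrite fmonom1E [i1hat m 1]alghom1 [delta 1]alghom1 [LHS]alghom1; symmetry.
    exact: alghom1.
  rewrite -(letterM C a (FMonom w)) [i1hat m _]alghomM [delta _]alghomM.
  rewrite [LHS]alghomM [RHS]alghomM; congr (_ * _); last exact: IH.
  rewrite 2!alghom_letter [LHS]alghom_letter Delta_letter_spread.
  symmetry; apply: etrans (linearD (alghom _) _ _) _.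
  by apply: (congr2 +%R); exact: alghom_letter.
- rewrite [i1hat m _]alghomP [delta _]alghomP [LHS]alghomP [RHS]alghomP.
  exact: eq_lincomb xE yE.
Qed.
End TensorSquare.

(** * Comparison with the conditionally free product *)

Section EventuallyConstant.
Variables (C : numClosedFieldType) (G : choiceType).
Variables phi psi : bool -> {scalar freestar C G}.
Hypotheses (phi1 : forall s, phi s 1 = 1) (psi1 : forall s, psi s 1 = 1).
Variable Phi : {scalar {malg C[{fmonom (bool * sletter G)%type}]}}.
Hypothesis cfree_Phi : is_cfree_product phi psi Phi.

(** Agreement for large m is a linear condition on z, so it can be tested on
    alternating centred products, for which m may be their length. *)
Lemma spread_eventually_cfree z : exists M, forall m, (M <= m)%N ->
  tens_scalar (Phi_hat m.+1 (phi false) (psi false))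
              (Phi_hat m.+1 (phi true) (psi true))
    (spread (@tgen G m) (@star_order G m) z) = Phi z.
Proof.
move: z; apply: (alternating_centred_span psi1).
- exists 0%N => m _; have -> : spread (@tgen G m) (@star_order G m) 0 =
      0 :> freestar_tm2 C G m.+1.
    exact: alghom0.
  by rewrite !linear0.
- move=> c x y [Mx xE] [My yE]; exists (maxn Mx My) => m.
  rewrite geq_max => /andP[/xE {}xE /yE {}yE].
  have -> : spread (@tgen G m) (@star_order G m) (c *: x + y) =
      c *: spread (@tgen G m) (@star_order G m) x +
      spread (@tgen G m) (@star_order G m) y :> freestar_tm2 C G m.+1.
    exact: alghomP.
  rewrite [LHS]linearP [RHS]linearP; exact: (congr2 +%R (congr1 _ xE) yE).
move=> s ss s0; exists (size s) => m sm; rewrite (cfree_Phi.2 s ss s0).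
apply: (spread_alternating (@tsite1 G m) (@tsiteM G m) (@tsite_gen G m)
  phi1 psi1 _ (@star_order_uniq G m) (@mem_star_order G m) ss s0).
  exact: tens_Phi_hat_word.
exact: leqW.
Qed.
End EventuallyConstant.

Theorem corollary5p5 (R : realType) (G : choiceType)
    (phi1 psi1 phi2 psi2 : {scalar freestar (Cplx R) G})
    (hphi1 : is_state phi1) (hpsi1 : is_state psi1)
    (hphi2 : is_state phi2) (hpsi2 : is_state psi2)
    (Phi : {scalar {malg (Cplx R)[{fmonom (bool * sletter G)%type}]}})
    (hPhi : is_cfree_product (fun b : bool => if b then phi2 else phi1)
                             (fun b : bool => if b then psi2 else psi1) Phi)
    (x : freestar (Cplx R) G) :
  (fun m : nat => convolution (Phi_hat m.+1 phi1 psi1) (Phi_hat m.+1 phi2 psi2)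
                    (i1hat m x) : Cplx R) @ \oo --> (Phi (delta x) : Cplx R).
Proof.
have phi_unital (b : bool) : (if b then phi2 else phi1) 1 = 1.
  by case: b; [exact: hphi2.1 | exact: hphi1.1].
have psi_unital (b : bool) : (if b then psi2 else psi1) 1 = 1.
  by case: b; [exact: hpsi2.1 | exact: hpsi1.1].
have [M PhiE] := spread_eventually_cfree phi_unital psi_unital hPhi (delta x).
apply: cvg_near_cst; exists M => // m /= /PhiE <-.
by rewrite -Delta_i1hat.
Qed.
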